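(* Let $A$ be a locally unital graded algebra that is locally finite-dimensional and bounded below, equipped with a graded triangular basis. For each $b\in\mathbf B$, the standard module $\Delta(b)$ has a unique irreducible graded quotient, denoted $L(b)$. This $L(b)$ is also (up to isomorphism in $A$-gmod) the unique irreducible graded submodule of the costandard module $\nabla(b)$. Moreover, the modules $L(b)$ $(b\in\mathbf B)$ give a full set of irreducible graded left $A$-modules up to isomorphism and degree shift, i.e. every irreducible graded left $A$-module is isomorphic to a degree shift of $L(b)$ for exactly one $b\in\mathbf B$.
   Context: Conventions. $\Bbbk$ is an algebraically closed field; all algebras, categories and functors are $\Bbbk$-linear; graded means $\mathbb Z$-graded. A locally unital graded algebra is a graded associative algebra $A=\bigoplus_{i,j\in\mathbf I}1_iA1_j$ with a given family of mutually orthogonal homogeneous idempotents $1_i$ $(i\in\mathbf I)$. Graded left modules are locally unital: $V=\bigoplus_{i}1_iV$. $A$-gmod is the abelian category of graded left $A$-modules with degree-preserving homomorphisms. $\operatorname{Hom}_A(V,W)=\bigoplus_{d\in\mathbb Z}\operatorname{Hom}_A(V,W)_d$, where $\operatorname{Hom}_A(V,W)_d$ is the space of $A$-module homomorphisms $f$ with $f(V_n)\subseteq W_{n+d}$ for all $n$. $A$ is locally finite-dimensional and bounded below if all $(1_iA1_j)_d$ are finite-dimensional and, for all $i,j$, $(1_iA1_j)_d=0$ for $d\ll 0$. Graded triangular basis. For such $A$ this is the following data: a subset $\mathbf S\subseteq\mathbf I$; a poset $(\Lambda,\leq)$ that is lower finite (each $\{\mu\in\Lambda:\mu\leq\lambda\}$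 is finite); a function $\mathbf S\to\Lambda$, $s\mapsto\dot s$, with finite (possibly empty) fibers $\mathbf S_\lambda$; homogeneous sets $\mathrm X(i,s)\subset1_iA1_s$, $\mathrm H(s,t)\subset1_sA1_t$, $\mathrm Y(t,j)\subset1_tA1_j$ for $i,j\in\mathbf I$, $s,t\in\mathbf S$. With $\mathrm X(s)=\bigcup_i\mathrm X(i,s)$, $\mathrm Y(t)=\bigcup_j\mathrm Y(t,j)$, the axioms are: (A1) the products $xhy$ for $(x,h,y)\in\bigcup_{s,t\in\mathbf S}\mathrm X(s)\times\mathrm H(s,t)\times\mathrm Y(t)$ form a basis of $A$; (A2) $\mathrm X(s,s)=\mathrm Y(s,s)=\{1_s\}$ for $s\in\mathbf S$; (A3) for $s\neq t$ in $\mathbf S$: $\mathrm X(s,t)\neq\varnothing\Rightarrow\dot s>\dot t$, $\mathrm H(s,t)\neq\varnothing\Rightarrow\dot s=\dot t$, $\mathrm Y(s,t)\neq\varnothing\Rightarrow\dot s<\dot t$; (A4) for each $i\in\mathbf I-\mathbf S$, the sets $\{s\in\mathbf S:\mathrm X(i,s)\neq\varnothing\}$ and $\{s\in\mathbf S:\mathrm Y(s,i)\neq\varnothing\}$ are finite. Functors. For $\lambda\in\Lambda$ let $e_\lambda=\sum_{s\in\mathbf S_\lambda}1_s$; let $A_{\geq\lambda}$ be the quotient of $A$ by the two-sided ideal generated by all $e_\mu$ with $\mu\not\geq\lambda$ (with idempotents the images $\bar1_i$), let $\bar e_\lambda$ be the image of $e_\lambda$ in it, and let $A_\lambda=\bar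 e_\lambda A_{\geq\lambda}\bar e_\lambda$, a unital graded algebra. Let $j^\lambda:A_{\geq\lambda}\text{-gmod}\to A_\lambda\text{-gmod}$, $V\mapsto\bar e_\lambda V$, with left adjoint $j^\lambda_!=A_{\geq\lambda}\bar e_\lambda\otimes_{A_\lambda}-$ and right adjoint $j^\lambda_*=\bigoplus_{i\in\mathbf I}\operatorname{Hom}_{A_\lambda}(\bar e_\lambda A_{\geq\lambda}\bar1_i,-)$. $A_{\geq\lambda}$-modules are viewed as $A$-modules by inflation. Standard and costandard modules. Fix a set $\mathbf B=\coprod_{\lambda\in\Lambda}\mathbf B_\lambda$ such that $L_\lambda(b)$ $(b\in\mathbf B_\lambda)$ is a full set of irreducible graded left $A_\lambda$-modules up to isomorphism and degree shift. Let $P_\lambda(b)$ and $I_\lambda(b)$ be a projective cover and an injective hull of $L_\lambda(b)$ in $A_\lambda$-gmod. For $b\in\mathbf B_\lambda$, $\Delta(b)=j^\lambda_!P_\lambda(b)$ and $\nabla(b)=j^\lambda_*I_\lambda(b)$, viewed as graded $A$-modules. *)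

(* Defs.v *)
From HB Require Import structures.
From mathcomp Require Import all_boot all_order all_algebra.
From mathcomp Require Import boolp classical_sets functions cardinality fsbigop.
From mathcomp Require Import freeg.

Set Implicit Arguments.
Unset Strict Implicit.
Unset Printing Implicit Defensive.
Import Order.TTheory GRing.Theory Num.Theory.
Local Open Scope classical_set_scope.
Local Open Scope ring_scope.

Section InternalSums.
Context (K : fieldType) (V : lmodType K).

Definition is_subspace (W : set V) : Prop :=
  W 0 /\ forall (c : K) u v, W u -> W v -> W (c *: u + v).

Record subspace := Subspace {
  subspace_mem :> V -> Prop; _ : is_subspace subspace_mem }.

Lemma subspaceP (W : subspace) : is_subspace (subspace_mem W).
Proof. by case: W. Qed.

Definition span (G : set V) : set V :=
  [set v | forall W : set V, is_subspace W -> G `<=` W -> W v].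

(* The internal sum of the [P j]: finite sums with the term of index j in [P j]. *)
Definition isum (J : choiceType) (P : J -> set V) : set V :=
  [set v | exists (r : seq J) (f : J -> V),
     [/\ uniq r, forall j, j \in r -> P j (f j) & v = \sum_(j <- r) f j]].

Definition independent (J : choiceType) (P : J -> set V) : Prop :=
  forall (r : seq J) (f : J -> V), uniq r -> (forall j, j \in r -> P j (f j)) ->
    \sum_(j <- r) f j = 0 -> forall j, j \in r -> f j = 0.

Definition direct_sum (J : choiceType) (P : J -> set V) : Prop :=
  (forall v, isum P v) /\ independent P.

Definition findim (W : set V) : Prop :=
  exists s : seq V, (forall v, v \in s -> W v) /\ W `<=` span [set` s].

(* The family [f j], for j in D, is a basis of V. *)
Definition is_basis (J : choiceType) (D : set J) (f : J -> V) : Prop :=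
  (forall (r : seq J) (c : J -> K), uniq r -> (forall j, j \in r -> D j) ->
     \sum_(j <- r) c j *: f j = 0 -> forall j, j \in r -> c j = 0) /\
  (forall v, span (f @` D) v).

End InternalSums.

Section InternalSumsTheory.
Context (K : fieldType).
Implicit Types (V U : lmodType K) (J : choiceType).

Lemma is_subspaceD V (W : set V) u v : is_subspace W -> W u -> W v -> W (u + v).
Proof. by move=> [_ h] hu hv; rewrite -[u]scale1r; exact: h. Qed.

Lemma is_subspaceZ V (W : set V) c v : is_subspace W -> W v -> W (c *: v).
Proof. by move=> [h0 h] hv; rewrite -[_ *: _]addr0; exact: h. Qed.

Lemma is_subspaceB V (W : set V) u v : is_subspace W -> W u -> W v -> W (u - v).
Proof. by move=> h hu hv; rewrite -scaleN1r addrC; apply: h.2. Qed.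

Lemma is_subspace_sum V (W : set V) (I : eqType) (r : seq I) (f : I -> V) :
  is_subspace W -> (forall i, i \in r -> W (f i)) -> W (\sum_(i <- r) f i).
Proof.
move=> hW hf; rewrite big_seq; elim/big_rec: _ => [|i v ir hv]; first exact: hW.1.
exact: is_subspaceD (hf i ir) hv.
Qed.

Lemma span_subspace V (G : set V) : is_subspace (span G).
Proof.
split=> [W [] //|c u v hu hv W hW hG].
by apply: hW.2; [exact: hu|exact: hv].
Qed.

Lemma span_gen V (G : set V) v : G v -> span G v.
Proof. by move=> Gv W _; apply. Qed.

Lemma span_ind V (G W : set V) : is_subspace W -> G `<=` W -> span G `<=` W.
Proof. by move=> hW hG v; apply. Qed.

Lemma big_ext V J (r t : seq J) (f : J -> V) : uniq r -> uniq t ->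
  {subset r <= t} -> \sum_(j <- t) (if j \in r then f j else 0) = \sum_(j <- r) f j.
Proof.
move=> ur ut st; rewrite -big_mkcond -big_filter; apply: perm_big.
apply: uniq_perm => //; first exact: filter_uniq.
by move=> j; rewrite mem_filter andbC; case: (boolP (j \in r)) => [/st ->|]; rewrite ?andbF.
Qed.

Lemma isum_subspace V J (P : J -> set V) :
  (forall j, is_subspace (P j)) -> is_subspace (isum P).
Proof.
move=> hP; split; first by exists [::], (fun=> 0); split=> //; rewrite big_nil.
move=> c u v [r [f [ur hf ->]]] [r' [g [ur' hg ->]]].
exists (undup (r ++ r')), (fun j => c *: (if j \in r then f j else 0) +
  (if j \in r' then g j else 0)); split; first exact: undup_uniq.
  move=> j _; apply: (hP j).2.
    by case: ifP => // jr; [exact: hf|exact: (hP j).1].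
  by case: ifP => // jr; [exact: hg|exact: (hP j).1].
rewrite big_split /= -scaler_sumr !big_ext ?undup_uniq //.
  by move=> j jr; rewrite mem_undup mem_cat jr orbT.
by move=> j jr; rewrite mem_undup mem_cat jr.
Qed.

Lemma isum1 V J (P : J -> set V) j v : P j v -> isum P v.
Proof.
move=> Pv; exists [:: j], (fun=> v); split=> //; last by rewrite big_seq1.
by move=> k; rewrite inE => /eqP ->.
Qed.

Lemma isum_ind V J (P : J -> set V) (W : set V) :
  is_subspace W -> (forall j v, P j v -> W v) -> isum P `<=` W.
Proof.
move=> hW h v [r [f [_ hf ->]]]; apply: is_subspace_sum => // j jr.
exact: h (hf j jr).
Qed.

Lemma linear_preimage U V (f : U -> V) (W : set V) :
  linear f -> is_subspace W -> is_subspace (f @^-1` W).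
Proof.
move=> lf hW; split=> [|c u v] /=.
  have /eqP := lf 1 0 0; rewrite !scale1r !addr0 => /eqP h.
  by have -> : f 0 = 0; [apply: (addrI (f 0)); rewrite -h addr0|exact: hW.1].
by move=> hu hv; rewrite lf; exact: hW.2.
Qed.

Lemma linear0f U V (f : U -> V) : linear f -> f 0 = 0.
Proof.
move=> lf; have := lf 1 0 0; rewrite !scale1r !addr0 => h.
by apply: (addrI (f 0)); rewrite -h addr0.
Qed.

Lemma linearDf U V (f : U -> V) u v : linear f -> f (u + v) = f u + f v.
Proof. by move=> lf; have := lf 1 u v; rewrite !scale1r. Qed.

Lemma linearZf U V (f : U -> V) c v : linear f -> f (c *: v) = c *: f v.
Proof. by move=> lf; have := lf c v 0; rewrite !addr0 (linear0f lf) addr0. Qed.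

Lemma linear_sumf U V (f : U -> V) (I : Type) (r : seq I) (g : I -> U) :
  linear f -> f (\sum_(i <- r) g i) = \sum_(i <- r) f (g i).
Proof.
move=> lf; elim: r => [|i r IH]; first by rewrite !big_nil linear0f.
by rewrite !big_cons linearDf // IH.
Qed.

Lemma linear_image U V (f : U -> V) (W : set U) :
  linear f -> is_subspace W -> is_subspace (f @` W).
Proof.
move=> lf hW; split; first by exists 0; [exact: hW.1|exact: linear0f].
move=> c _ _ [u hu <-] [v hv <-]; exists (c *: u + v); first exact: hW.2.
by rewrite lf.
Qed.

Lemma setT_subspace V : is_subspace [set: V].
Proof. by []. Qed.

Lemma setI_subspace V (W W' : set V) :
  is_subspace W -> is_subspace W' -> is_subspace (W `&` W').
Proof. by move=> h h'; split=> [|c u v [] ? ? []]; split; [exact: h.1|exact: h'.1|exact: h.2|exact: h'.2]. Qed.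

Lemma isum_morph U V J J' (P : J -> set U) (Q : J' -> set V) (f : U -> V) :
  linear f -> (forall j, is_subspace (Q j)) ->
  (forall j v, P j v -> isum Q (f v)) -> forall v, isum P v -> isum Q (f v).
Proof.
move=> lf hQ h; apply: (@isum_ind _ _ _ (f @^-1` isum Q)); last exact: h.
by apply: linear_preimage => //; exact: isum_subspace.
Qed.

Lemma independent_proj V J (P : J -> set V) (g : J -> V -> V) :
  (forall j, linear (g j)) -> (forall j v, P j v -> g j v = v) ->
  (forall j k v, j != k -> P k v -> g j v = 0) -> independent P.
Proof.
move=> lg g1 g0 r f ur hf s0 j jr.
have := linear0f (lg j); rewrite -s0 linear_sumf // (bigD1_seq j) //= g1 ?hf //.
rewrite big1_seq ?addr0 // => k /andP[kj kr].
  by apply: g0 (hf k kr); rewrite eq_sym.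
exact: hf.
Qed.

Section Components.
Context V J (P : J -> set V) (hP : forall j, is_subspace (P j)) (dP : direct_sum P).

Definition csupp v : seq J := projT1 (cid (dP.1 v)).
Definition cfun v : J -> V := projT1 (cid (projT2 (cid (dP.1 v)))).
Definition icomp j v := if j \in csupp v then cfun v j else 0.

Lemma cfunP v : [/\ uniq (csupp v), forall j, j \in csupp v -> P j (cfun v j) &
  v = \sum_(j <- csupp v) cfun v j].
Proof. exact: projT2 (cid (projT2 (cid (dP.1 v)))). Qed.

Lemma csupp_uniq v : uniq (csupp v). Proof. by case: (cfunP v). Qed.

Lemma icompP j v : P j (icomp j v).
Proof. by rewrite /icomp; case: ifP => h; [case: (cfunP v) => _ + _; apply|exact: (hP j).1]. Qed.

Lemma icomp_out j v : j \notin csupp v -> icomp j v = 0.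
Proof. by rewrite /icomp => /negPf ->. Qed.

Lemma icomp_sum v : v = \sum_(j <- csupp v) icomp j v.
Proof.
case: (cfunP v) => _ _ {1}->; apply: eq_big_seq => j jr.
by rewrite /icomp jr.
Qed.

Lemma icomp_uniq v (r : seq J) (f : J -> V) : uniq r ->
  (forall j, j \in r -> P j (f j)) -> v = \sum_(j <- r) f j ->
  forall j, icomp j v = if j \in r then f j else 0.
Proof.
move=> ur hf ev j; pose t := undup (csupp v ++ r).
have ut : uniq t by exact: undup_uniq.
have st k : k \notin t -> icomp k v = if k \in r then f k else 0.
  rewrite mem_undup mem_cat negb_or => /andP[kc /negPf ->]; exact: icomp_out.
have [jt|/st //] := boolP (j \in t).
apply/eqP; rewrite -subr_eq0; apply/eqP; move: j jt.
apply: (dP.2 t (fun j => icomp j v - (if j \in r then f j else 0))) => //.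
  move=> j _; apply: is_subspaceB => //; first exact: icompP.
  by case: ifP => h; [exact: hf|exact: (hP j).1].
rewrite sumrB /icomp !big_ext ?csupp_uniq //; last 2 first.
- by move=> k kr; rewrite mem_undup mem_cat kr orbT.
- by move=> k kr; rewrite mem_undup mem_cat kr.
by case: (cfunP v) => _ _ <-; rewrite -ev subrr.
Qed.

Lemma icomp_id j v : P j v -> icomp j v = v.
Proof.
move=> Pv; rewrite (@icomp_uniq v [:: j] (fun=> v)) ?inE ?eqxx ?big_seq1 //.
by move=> k; rewrite inE => /eqP ->.
Qed.

Lemma icomp_ne j k v : j != k -> P k v -> icomp j v = 0.
Proof.
move=> jk Pv; rewrite (@icomp_uniq v [:: k] (fun=> v)) ?inE ?(negPf jk) ?big_seq1 //.
by move=> l; rewrite inE => /eqP ->.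
Qed.

Lemma icomp_linear j : linear (icomp j).
Proof.
move=> c u v; pose t := undup (csupp u ++ csupp v).
have ut : uniq t by exact: undup_uniq.
have su : {subset csupp u <= t} by move=> k kr; rewrite mem_undup mem_cat kr.
have sv : {subset csupp v <= t} by move=> k kr; rewrite mem_undup mem_cat kr orbT.
rewrite (@icomp_uniq _ t (fun k => c *: icomp k u + icomp k v)) //.
- case: ifPn => // jt; rewrite !icomp_out ?scaler0 ?addr0 //.
    by apply: contra jt => /sv.
  by apply: contra jt => /su.
- by move=> k _; apply: (hP k).2; exact: icompP.
rewrite big_split /= -scaler_sumr /icomp !big_ext ?csupp_uniq //.
by case: (cfunP u) => _ _ <-; case: (cfunP v) => _ _ <-.
Qed.

End Components.
End InternalSumsTheory.

Section Subspaces.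
Context (K : fieldType) (V : lmodType K) (W : subspace V).

Definition subspace_pred : {pred V} := fun v => `[< W v >].

Lemma subspace_predP v : reflect (W v) (v \in subspace_pred).
Proof. exact: asboolP. Qed.

Lemma subspace_pred_closed : submod_closed subspace_pred.
Proof.
split=> [|c u v /subspace_predP hu /subspace_predP hv]; apply/subspace_predP.
  exact: (subspaceP W).1.
exact: (subspaceP W).2.
Qed.

HB.instance Definition _ :=
  GRing.isSubmodClosed.Build K V subspace_pred subspace_pred_closed.

Record subsp := Subsp { subsp_val : V; subsp_mem : subsp_val \in subspace_pred }.

HB.instance Definition _ := [isSub for subsp_val].
HB.instance Definition _ := [Choice of subsp by <:].
HB.instance Definition _ := [SubChoice_isSubLmodule of subsp by <:].

Definition subsp_of v (h : W v) : subsp := Subsp (introT (subspace_predP v) h).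

Lemma subspP (u : subsp) : W (subsp_val u).
Proof. exact/subspace_predP/subsp_mem. Qed.

Lemma subsp_val_linear : linear subsp_val.
Proof. by move=> c u v; rewrite -[subsp_val]/(val : subsp -> V) linearP. Qed.

Lemma subsp_inj u v : subsp_val u = subsp_val v -> u = v.
Proof. exact: val_inj. Qed.

Definition quosp : Type := Quotient.quot subspace_pred.

HB.instance Definition _ := GRing.Zmodule.on quosp.

Definition quo_pi (v : V) : quosp := \pi_(Quotient.quot subspace_pred)%qT v.
Definition quo_repr (u : quosp) : V := generic_quotient.repr u.

Lemma quo_reprK u : quo_pi (quo_repr u) = u.
Proof. exact: generic_quotient.reprK. Qed.

Lemma quo_piP u v : quo_pi u = quo_pi v <-> W (u - v).
Proof.
split=> [/eqP|h]; last apply/eqP; rewrite -Quotient.idealrBE.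
  by move/subspace_predP.
exact/subspace_predP.
Qed.

Lemma quo_piD u v : quo_pi (u + v) = quo_pi u + quo_pi v.
Proof. exact: (raddfD (\pi_(Quotient.quot subspace_pred)%qT)). Qed.

Definition quo_scale (c : K) (u : quosp) : quosp := quo_pi (c *: quo_repr u).

Lemma quo_piZ c v : quo_pi (c *: v) = quo_scale c (quo_pi v).
Proof.
apply/quo_piP; rewrite -scalerBr; apply: is_subspaceZ; first exact: subspaceP.
by apply/quo_piP; rewrite quo_reprK.
Qed.

Lemma quo_scaleA c d u : quo_scale c (quo_scale d u) = quo_scale (c * d) u.
Proof. by rewrite -[u]quo_reprK -!quo_piZ scalerA. Qed.

Lemma quo_scale1 : left_id 1 quo_scale.
Proof. by move=> u; rewrite -[u]quo_reprK -quo_piZ scale1r. Qed.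

Lemma quo_scaleDr : right_distributive quo_scale +%R.
Proof.
move=> c u v; rewrite -[u]quo_reprK -[v]quo_reprK -quo_piD -!quo_piZ.
by rewrite scalerDr quo_piD.
Qed.

Lemma quo_scaleDl u : {morph quo_scale^~ u : c d / c + d}.
Proof. by move=> c d; rewrite -[u]quo_reprK -!quo_piZ scalerDl quo_piD. Qed.

HB.instance Definition _ := GRing.Zmodule_isLmodule.Build K quosp
  quo_scaleA quo_scale1 quo_scaleDr quo_scaleDl.

Lemma quo_pi_linear : linear quo_pi.
Proof. by move=> c u v; rewrite quo_piD quo_piZ. Qed.

Lemma quo_pi0 v : quo_pi v = 0 <-> W v.
Proof. by rewrite -(linear0f quo_pi_linear) quo_piP subr0. Qed.

Section Lift.
Context (U : lmodType K) (f : V -> U) (lf : linear f) (f0 : forall v, W v -> f v = 0).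

Definition quo_lift (u : quosp) : U := f (quo_repr u).

Lemma quo_liftE v : quo_lift (quo_pi v) = f v.
Proof.
apply/eqP; rewrite -subr_eq0; apply/eqP.
rewrite -scaleN1r addrC -lf; apply: f0; rewrite addrC scaleN1r.
by apply/quo_piP; rewrite quo_reprK.
Qed.

Lemma quo_lift_linear : linear quo_lift.
Proof.
move=> c u v; rewrite -[u]quo_reprK -[v]quo_reprK -quo_pi_linear !quo_liftE.
exact: lf.
Qed.
End Lift.
End Subspaces.

Section GradedSpaces.
Context (K : fieldType).

Record gspace := GSpace {
  gcar :> lmodType K;
  gdeg : int -> set gcar;
  gdeg_subspace : forall d, is_subspace (gdeg d);
  gdeg_sum : direct_sum gdeg
}.

(* A graded subspace is one spanned by homogeneous vectors. *)
Record gsubspace (V : gspace) := GSubspace {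
  gsub_mem :> subspace V;
  gsubP : forall v, gsub_mem v ->
    isum (fun d => [set w | gdeg d w /\ gsub_mem w]) v
}.

Definition homogeneous (V : gspace) (v : V) : Prop := exists d, gdeg d v.

Lemma gdegS (V : gspace) d : is_subspace (@gdeg V d).
Proof. exact: gdeg_subspace. Qed.

Definition gcomp (V : gspace) (d : int) (v : V) : V := icomp (gdeg_sum V) d v.

Lemma gcomp_linear (V : gspace) d : linear (@gcomp V d).
Proof. exact: icomp_linear (gdegS V) _ _. Qed.

Lemma gcompP (V : gspace) d v : gdeg d (@gcomp V d v).
Proof. exact: icompP (gdegS V) _ _ _. Qed.

Lemma gcomp_id (V : gspace) d (v : V) : gdeg d v -> gcomp d v = v.
Proof. exact: icomp_id (gdegS V) _ _ _. Qed.

Lemma gcomp_ne (V : gspace) d e (v : V) : d != e -> gdeg e v -> gcomp d v = 0.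
Proof. exact: icomp_ne (gdegS V) _ _ _ _. Qed.

Lemma gspace_ind (V : gspace) (W : set V) : is_subspace W ->
  (forall d v, gdeg d v -> W v) -> forall v, W v.
Proof. by move=> hW h v; exact: isum_ind hW h v ((gdeg_sum V).1 v). Qed.

Lemma gdeg_uniq (V : gspace) (v : V) d e : gdeg d v -> gdeg e v -> d != e -> v = 0.
Proof. by move=> hd he de; rewrite -(gcomp_id hd) (gcomp_ne de he). Qed.

Lemma gsub_comp (V : gspace) (W : gsubspace V) v d : W v -> W (gcomp d v).
Proof.
move=> /gsubP [r [f [ur hf ev]]]; rewrite /gcomp.
rewrite (icomp_uniq (gdegS V) (gdeg_sum V) ur _ ev) => [|j /hf[]//].
by case: ifP => [/hf[]//|_]; exact: (subspaceP W).1.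
Qed.

Section SubQuotient.
Context (V : gspace) (W : gsubspace V).

Definition gsub_deg (d : int) : set (subsp W) := [set u | gdeg d (subsp_val u)].

Lemma gsub_deg_subspace d : is_subspace (gsub_deg d).
Proof.
exact: (@linear_preimage _ (subsp W) V (@subsp_val _ _ W) (gdeg d)
  (@subsp_val_linear _ _ W) (gdegS V d)).
Qed.

Lemma gsub_deg_sum : direct_sum gsub_deg.
Proof.
split=> [u|].
  pose Q := [set v : V | exists u : subsp W, subsp_val u = v /\ isum gsub_deg u].
  have hQ : is_subspace Q.
    have h := isum_subspace gsub_deg_subspace.
    split=> [|c _ _ [u1 [<- h1]] [u2 [<- h2]]].
      exists 0; split; [exact: linear0f (@subsp_val_linear _ _ W)|exact: h.1].
    exists (c *: u1 + u2); split; [exact: subsp_val_linear|exact: h.2].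
  have : Q (subsp_val u).
    apply: (isum_ind hQ _ (gsubP (subspP u))) => d w [hd hw].
    by exists (subsp_of hw); split=> //; exact: (isum1 (j := d)).
  by case=> u' [/subsp_inj ->].
move=> r f ur hf s0 j jr; apply: subsp_inj.
rewrite (linear0f (@subsp_val_linear _ _ W)).
apply: ((gdeg_sum V).2 r (fun j => subsp_val (f j))) => //.
rewrite -(linear_sumf _ _ (@subsp_val_linear _ _ W)) s0.
exact: linear0f (@subsp_val_linear _ _ W).
Qed.

Definition gsub : gspace := GSpace gsub_deg_subspace gsub_deg_sum.

Definition gquo_deg (d : int) : set (quosp W) := @quo_pi _ _ W @` gdeg d.

Lemma gquo_deg_subspace d : is_subspace (gquo_deg d).
Proof.
exact: (@linear_image _ V (quosp W) (@quo_pi _ _ W) (gdeg d)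
  (@quo_pi_linear _ _ W) (gdegS V d)).
Qed.

Lemma gquo_deg_sum : direct_sum gquo_deg.
Proof.
split=> [u|].
  rewrite -[u]quo_reprK.
  apply: (isum_morph (@quo_pi_linear _ _ W) gquo_deg_subspace _ ((gdeg_sum V).1 _)).
  by move=> d v hv; apply: (isum1 (j := d)); exists v.
pose g d : quosp W -> quosp W := quo_lift (fun v => quo_pi W (gcomp d v)).
have l1 d : linear (fun v => quo_pi W (gcomp d v)).
  by move=> a u v; rewrite gcomp_linear quo_pi_linear.
have k1 d v : W v -> quo_pi W (gcomp d v) = 0.
  by move=> hv; apply/quo_pi0; exact: gsub_comp.
apply: (@independent_proj _ _ _ _ g) => [d|d _ [v hv <-]|d e _ de [v hv <-]].
- exact: quo_lift_linear (l1 d) (k1 d).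
- rewrite /g (quo_liftE (l1 d) (k1 d)); congr quo_pi.
  exact: gcomp_id.
- rewrite /g (quo_liftE (l1 d) (k1 d)).
  rewrite (gcomp_ne de hv).
  exact: linear0f (@quo_pi_linear _ _ W).
Qed.

Definition gquo : gspace := GSpace gquo_deg_subspace gquo_deg_sum.

End SubQuotient.

Section Shift.
Context (V : gspace) (n : int).

Lemma shift_deg_sum : direct_sum (fun d => @gdeg V (d + n)).
Proof.
split=> [v|].
  apply: isum_ind ((gdeg_sum V).1 v); first by apply: isum_subspace => j; exact: gdeg_subspace.
  by move=> d w hw; apply: (isum1 (j := d - n)); rewrite subrK.
move=> r f ur hf s0 j jr.
apply: (@independent_proj _ _ _ (fun d => @gdeg V (d + n))
  (fun d => @gcomp V (d + n)) _ _ _ r f ur hf s0 j jr) => [d|d w hw|d e w de hw].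
- exact: gcomp_linear.
- exact: gcomp_id.
- by apply: gcomp_ne hw; rewrite (inj_eq (addIr n)).
Qed.

Definition gshift : gspace :=
  @GSpace V (fun d => gdeg (d + n)) (fun d => gdegS V (d + n)) shift_deg_sum.
End Shift.

Section Image.
Context (V U : gspace) (f : V -> U) (lf : linear f)
  (df : forall d v, gdeg d v -> gdeg d (f v)).

Definition im_subspace : subspace U :=
  Subspace (linear_image lf (@setT_subspace _ V)).

Lemma gimageP v : im_subspace v ->
  isum (fun d => [set w | gdeg d w /\ im_subspace w]) v.
Proof.
case=> u _ <-; apply: (isum_morph lf _ _ ((gdeg_sum V).1 u)).
  move=> d; apply: setI_subspace; [exact: gdeg_subspace|exact: subspaceP].
by move=> d w hw; apply: (isum1 (j := d)); split; [exact: df|exists w].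
Qed.

Definition gimage : gsubspace U := GSubspace gimageP.
End Image.

End GradedSpaces.

Section Algebras.
Context (K : fieldType).

(* Locally unital graded algebras: A need not have a unit, so that the ring
   structures of the library do not apply. The idempotents are the [lid i]. *)
Record lualg (I : choiceType) := LUAlg {
  lspace :> gspace K;
  lmul : lspace -> lspace -> lspace;
  lid : I -> lspace;
  lmul_linl : forall b, linear (fun a => lmul a b);
  lmul_linr : forall a, linear (lmul a);
  lmulA : forall a b c, lmul a (lmul b c) = lmul (lmul a b) c;
  lmul_deg : forall d e a b, gdeg d a -> gdeg e b -> gdeg (d + e) (lmul a b);
  lid_homog : forall i, homogeneous (lid i);
  lid_idem : forall i, lmul (lid i) (lid i) = lid i;
  lid_orth : forall i j, i <> j -> lmul (lid i) (lid j) = 0;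
  lid_sum : direct_sum (fun ij : I * I =>
    [set a | exists b, a = lmul (lmul (lid ij.1) b) (lid ij.2)])
}.

Arguments lid {I} l i.

(* The subspace 1_i A 1_j *)
Definition peirce (I : choiceType) (A : lualg I) (i j : I) : set A :=
  [set a | exists b, a = lmul (lmul (lid A i) b) (lid A j)].

Arguments peirce {I} A i j _.

Definition locally_findim (I : choiceType) (A : lualg I) : Prop :=
  forall i j d, findim (peirce A i j `&` gdeg d).

Definition bounded_below (I : choiceType) (A : lualg I) : Prop :=
  forall i j, exists N : int, forall d : int, (d < N)%R ->
    peirce A i j `&` gdeg d `<=` [set 0].

Record gmod (I : choiceType) (A : lualg I) := GMod {
  mspace :> gspace K;
  act : A -> mspace -> mspace;
  act_linl : forall v, linear (fun a => act a v);
  act_linr : forall a, linear (act a);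
  actA : forall a b v, act (lmul a b) v = act a (act b v);
  act_deg : forall d e a v, gdeg d a -> gdeg e v -> gdeg (d + e) (act a v);
  act_sum : direct_sum (fun i : I => [set v | exists w, v = act (lid A i) w])
}.

End Algebras.

Arguments lid {K I} l i.
Arguments peirce {K I} A i j _.

Section AlgebraTheory.
Context (K : fieldType) (I : choiceType).

Lemma peirce_independent (V : lmodType K) (mul : V -> V -> V) (e : I -> V)
    (ll : forall b, linear (fun a => mul a b)) (lr : forall a, linear (mul a))
    (mA : forall a b c, mul a (mul b c) = mul (mul a b) c)
    (ei : forall i, mul (e i) (e i) = e i)
    (eo : forall i j, i <> j -> mul (e i) (e j) = 0) :
  independent (fun ij : I * I =>
    [set a | exists b, a = mul (mul (e ij.1) b) (e ij.2)]).
Proof.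
have z1 a : mul 0 a = 0 by exact: linear0f (ll a).
have z2 a : mul a 0 = 0 by exact: linear0f (lr a).
apply: (@independent_proj _ _ _ _ (fun ij a => mul (mul (e ij.1) a) (e ij.2))).
- by move=> ij c u v; rewrite lr ll.
- move=> [i j] _ [b ->] /=.
  by rewrite -[RHS]mA -(ei i) -[X in _ = mul (mul _ _) (mul _ X)]ei !mA ?ei -!mA ?ei.
- move=> [i j] [k l] _ ijkl [b ->] /=.
  have [eik|/eqP/eo h] := eqVneq i k; last by rewrite !mA h !z1.
  have [ejl|nlj] := eqVneq l j; first by rewrite eik ejl eqxx in ijkl.
  by rewrite -!mA eo ?z2 // => ejl; rewrite ejl eqxx in nlj.
Qed.

Lemma act_independent (A V : lmodType K) (act : A -> V -> V) (mul : A -> A -> A)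
    (e : I -> A) (ll : forall v, linear (fun a => act a v))
    (lr : forall a, linear (act a))
    (actA : forall a b v, act (mul a b) v = act a (act b v))
    (ei : forall i, mul (e i) (e i) = e i)
    (eo : forall i j, i <> j -> mul (e i) (e j) = 0) :
  independent (fun i : I => [set v | exists w, v = act (e i) w]).
Proof.
apply: (@independent_proj _ _ _ _ (fun i => act (e i))) => //.
  by move=> i _ [w ->]; rewrite -actA ei.
move=> i j _ /eqP ij [w ->]; rewrite -actA eo //.
exact: linear0f (ll w).
Qed.

Section OneAlgebra.
Context (A : lualg K I).
Implicit Types (a b c : A).

Lemma lmul0l a : lmul 0 a = 0. Proof. exact: linear0f (lmul_linl a). Qed.
Lemma lmul0r a : lmul a 0 = 0. Proof. exact: linear0f (lmul_linr a). Qed.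

Lemma lmulBl a b c : lmul (a - b) c = lmul a c - lmul b c.
Proof. by rewrite -scaleN1r addrC lmul_linl scaleN1r addrC. Qed.
Lemma lmulBr a b c : lmul a (b - c) = lmul a b - lmul a c.
Proof. by rewrite -scaleN1r addrC lmul_linr scaleN1r addrC. Qed.

Lemma peirce_subspace i j : is_subspace (peirce A i j).
Proof.
split; first by exists 0; rewrite lmul0r lmul0l.
move=> c _ _ [u ->] [v ->]; exists (c *: u + v).
by rewrite lmul_linr lmul_linl.
Qed.

Lemma peirce_ind (W : set A) : is_subspace W ->
  (forall i j d b, gdeg d b -> W (lmul (lmul (lid A i) b) (lid A j))) ->
  forall a, W a.
Proof.
move=> hW h a; apply: (isum_ind hW _ ((lid_sum A).1 a)) => -[i j] _ [b ->] /=.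
apply: (@gspace_ind _ A (fun b => W (lmul (lmul (lid A i) b) (lid A j)))) => //.
  apply: (@linear_preimage _ A A (fun b => lmul (lmul (lid A i) b) (lid A j)) W) => //.
  by move=> c u v; rewrite lmul_linr lmul_linl.
by move=> d v hv; exact: h hv.
Qed.

Lemma idem_deg0 a : homogeneous a -> lmul a a = a -> gdeg 0 a.
Proof.
move=> [d hd] ha; have [d0|d0] := eqVneq d 0; first by rewrite -d0.
suff -> : a = 0 by exact: (gdegS A 0).1.
have h2 : gdeg (d + d) a by rewrite -ha; exact: lmul_deg.
apply: (gdeg_uniq h2 hd); apply: contra d0 => /eqP h.
by apply/eqP/(addrI d); rewrite addr0.
Qed.

Lemma lid_deg0 i : gdeg 0 (lid A i).
Proof. by apply: idem_deg0; [exact: lid_homog|exact: lid_idem]. Qed.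

Record gideal := GIdeal {
  gideal_sub :> gsubspace A;
  gidealP : forall a x, gideal_sub x ->
    gideal_sub (lmul a x) /\ gideal_sub (lmul x a)
}.

Section Quotient.
Context (N : gideal).
Local Notation Q := (gquo N).

Definition quo_mul (u v : Q) : Q := quo_pi N (lmul (quo_repr u) (quo_repr v)).

Lemma quo_mulE a b : quo_mul (quo_pi N a) (quo_pi N b) = quo_pi N (lmul a b).
Proof.
apply/quo_piP.
set a' := quo_repr _; set b' := quo_repr _.
have ha : N (a' - a) by apply/quo_piP; rewrite quo_reprK.
have hb : N (b' - b) by apply/quo_piP; rewrite quo_reprK.
have -> : lmul a' b' - lmul a b = lmul (a' - a) b' + lmul a (b' - b).
  by rewrite lmulBl lmulBr addrA subrK.
apply: is_subspaceD; first exact: subspaceP.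
  by case: (gidealP b' ha).
by case: (gidealP a hb).
Qed.
End Quotient.
End OneAlgebra.
End AlgebraTheory.

Section QuotientAlgebra.
Context (K : fieldType) (I : choiceType) (A : lualg K I) (N : gideal A).
Local Notation Q := (gquo N).

Lemma quo_mul_linl (v : Q) : linear (fun u : Q => quo_mul u v).
Proof.
move=> c u w; rewrite -[u]quo_reprK -[w]quo_reprK -[v]quo_reprK.
by rewrite -quo_pi_linear !quo_mulE -quo_pi_linear lmul_linl.
Qed.

Lemma quo_mul_linr (v : Q) : linear (@quo_mul _ _ _ N v).
Proof.
move=> c u w; rewrite -[u]quo_reprK -[w]quo_reprK -[v]quo_reprK.
by rewrite -quo_pi_linear !quo_mulE -quo_pi_linear lmul_linr.
Qed.

Lemma quo_mulA (u v w : Q) : quo_mul u (quo_mul v w) = quo_mul (quo_mul u v) w.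
Proof.
rewrite -[u]quo_reprK -[w]quo_reprK -[v]quo_reprK.
by rewrite !quo_mulE lmulA.
Qed.

Lemma quo_mul_deg d e (u v : Q) : gdeg d u -> gdeg e v -> gdeg (d + e) (quo_mul u v).
Proof.
move=> [a ha <-] [b hb <-]; rewrite quo_mulE.
by exists (lmul a b) => //; exact: lmul_deg.
Qed.

Definition quo_lid (i : I) : Q := quo_pi N (lid A i).

Lemma quo_lid_homog i : homogeneous (quo_lid i).
Proof. by exists 0; exists (lid A i) => //; exact: lid_deg0. Qed.

Lemma quo_lid_idem i : quo_mul (quo_lid i) (quo_lid i) = quo_lid i.
Proof. by rewrite quo_mulE lid_idem. Qed.

Lemma quo_lid_orth i j : i <> j -> quo_mul (quo_lid i) (quo_lid j) = 0.
Proof.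
by move=> ij; rewrite quo_mulE lid_orth //; exact: linear0f (@quo_pi_linear _ _ N).
Qed.

Lemma quo_lid_sum : direct_sum (fun ij : I * I =>
  [set a : Q | exists b, a = quo_mul (quo_mul (quo_lid ij.1) b) (quo_lid ij.2)]).
Proof.
split; last exact: peirce_independent quo_mul_linl quo_mul_linr quo_mulA
  quo_lid_idem quo_lid_orth.
move=> u; rewrite -[u]quo_reprK.
apply: (isum_morph (@quo_pi_linear _ _ N) _ _ ((lid_sum A).1 _)).
  move=> ij; split.
    exists 0; rewrite (linear0f (quo_mul_linr _)).
    by rewrite (linear0f (quo_mul_linl _)).
  move=> c _ _ [v ->] [w ->]; exists (c *: v + w).
  by rewrite quo_mul_linr quo_mul_linl.
move=> ij _ [b ->]; apply: (isum1 (j := ij)); exists (quo_pi N b).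
by rewrite /quo_lid !quo_mulE.
Qed.

Definition quo_alg : lualg K I :=
  LUAlg quo_mul_linl quo_mul_linr quo_mulA quo_mul_deg quo_lid_homog
    quo_lid_idem quo_lid_orth quo_lid_sum.

Section Inflation.
Context (V : gmod quo_alg).

Definition inflate_act (a : A) (v : V) : V := act (quo_pi N a : quo_alg) v.

Lemma inflate_linl v : linear (fun a => inflate_act a v).
Proof.
move=> c a b; rewrite /inflate_act quo_pi_linear.
exact: (act_linl v c (quo_pi N a : quo_alg)).
Qed.

Lemma inflate_actA a b v :
  inflate_act (lmul a b) v = inflate_act a (inflate_act b v).
Proof.
rewrite /inflate_act -quo_mulE.
exact: (actA (quo_pi N a : quo_alg) (quo_pi N b : quo_alg)).
Qed.

Lemma inflate_deg d e a v : gdeg d a -> gdeg e v -> gdeg (d + e) (inflate_act a v).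
Proof. by move=> ha hv; apply: act_deg => //; exists a. Qed.

Definition inflate : gmod A :=
  @GMod _ _ A V inflate_act inflate_linl (fun a => act_linr (quo_pi N a : quo_alg))
    inflate_actA inflate_deg (act_sum V).
End Inflation.
End QuotientAlgebra.

Section GeneratedIdeal.
Context (K : fieldType) (I : choiceType) (A : lualg K I) (G : set A).

Definition is_ideal (W : set A) : Prop := is_subspace W /\
  forall a x, W x -> W (lmul a x) /\ W (lmul x a).

Definition ideal_gen_set : set A :=
  [set x | forall W, is_ideal W -> G `<=` W -> W x].

Lemma ideal_gen_is_ideal : is_ideal ideal_gen_set.
Proof.
split.
  split=> [W [[h _] _] _ //|c u v hu hv W hW hG].
  by apply: hW.1.2; [exact: hu|exact: hv].
by move=> a x hx; split=> W hW hG; apply: (hW.2 a x _).1 || apply: (hW.2 a x _).2; exact: hx.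
Qed.

Definition ideal_gen_subspace : subspace A := Subspace ideal_gen_is_ideal.1.

Context (hG : forall x, G x -> homogeneous x).

Lemma ideal_gen_graded x : ideal_gen_subspace x ->
  isum (fun d => [set w | gdeg d w /\ ideal_gen_subspace w]) x.
Proof.
pose P d := [set w : A | gdeg d w /\ ideal_gen_subspace w].
have hP d : is_subspace (P d).
  by apply: setI_subspace; [exact: gdegS|exact: subspaceP].
have hW := isum_subspace hP.
apply; last first.
  move=> g Gg; have [d hd] := hG Gg; apply: (isum1 (j := d)); split=> //.
  by move=> W _; exact.
split=> // a y hy; split.
  apply: (@gspace_ind _ A [set a | isum P (lmul a y)]) => [|d b hb].
    exact: (@linear_preimage _ A A (fun a => lmul a y) _ (lmul_linl y) hW).
  apply: (@isum_ind _ A _ P [set y | isum P (lmul b y)]) hy.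
    exact: (@linear_preimage _ A A (lmul b) _ (lmul_linr b) hW).
  move=> e z [hz Nz]; apply: (isum1 (j := d + e)); split; first exact: lmul_deg.
  by case: (ideal_gen_is_ideal.2 b z Nz).
apply: (@gspace_ind _ A [set a | isum P (lmul y a)]) => [|d b hb].
  exact: (@linear_preimage _ A A (lmul y) _ (lmul_linr y) hW).
apply: (@isum_ind _ A _ P [set y | isum P (lmul y b)]) hy.
  exact: (@linear_preimage _ A A (fun y => lmul y b) _ (lmul_linl b) hW).
move=> e z [hz Nz]; apply: (isum1 (j := e + d)); split; first exact: lmul_deg.
by case: (ideal_gen_is_ideal.2 b z Nz).
Qed.

Definition ideal_gen : gideal A :=
  @GIdeal _ _ A (GSubspace ideal_gen_graded) ideal_gen_is_ideal.2.

End GeneratedIdeal.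

Section Modules.
Context (K : fieldType) (I : choiceType) (A : lualg K I).
Implicit Types V W : gmod A.

Lemma act0l V (v : V) : act (0 : A) v = 0. Proof. exact: linear0f (act_linl v). Qed.
Lemma act0r V (a : A) : act a (0 : V) = 0. Proof. exact: linear0f (act_linr a). Qed.

Lemma gmod_dec V (v : V) : exists r : seq I, v = \sum_(i <- r) act (lid A i) v.
Proof.
have [r [f [ur hf ev]]] := (act_sum V).1 v; exists r; rewrite {1}ev.
apply: eq_big_seq => i ir; rewrite ev (linear_sumf _ _ (act_linr _)).
rewrite (bigD1_seq i) //= big1_seq ?addr0 => [|j /andP[/eqP ji jr]].
  by have [w ->] := hf i ir; rewrite -actA lid_idem.
have [w ->] := hf j jr; rewrite -actA lid_orth ?act0l //.
by move=> ij; apply: ji.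
Qed.

Definition is_hom V W (d : int) (f : V -> W) : Prop :=
  [/\ linear f, forall a v, f (act a v) = act a (f v) &
      forall n v, gdeg n v -> gdeg (n + d) (f v)].

Definition iso V W : Prop := exists f : V -> W, is_hom 0 f /\ bijective f.

Record gsubmod V := GSubmod {
  gsubmod_sub :> gsubspace V;
  gsubmodP : forall a v, gsubmod_sub v -> gsubmod_sub (act a v)
}.

Definition irreducible V : Prop :=
  (exists v : V, v <> 0) /\
  forall N : gsubmod V, (forall v, N v -> v = 0) \/ (forall v, N v).

Section SubQuotient.
Context V (N : gsubmod V).

Definition sub_act (a : A) (u : gsub N) : gsub N :=
  subsp_of (gsubmodP a (subspP u)).

Lemma sub_act_linl u : linear (fun a => sub_act a u).
Proof.
move=> c a b; apply: subsp_inj; rewrite subsp_val_linear /=; exact: act_linl.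
Qed.

Lemma sub_act_linr a : linear (sub_act a).
Proof.
move=> c u v; apply: subsp_inj; rewrite [RHS]subsp_val_linear.
rewrite -[LHS]/(act a (subsp_val (c *: u + v))) subsp_val_linear.
exact: act_linr.
Qed.

Lemma sub_actA a b u : sub_act (lmul a b) u = sub_act a (sub_act b u).
Proof. by apply: subsp_inj; exact: actA. Qed.

Lemma sub_act_deg d e a u : gdeg d a -> gdeg e u -> gdeg (d + e) (sub_act a u).
Proof. by move=> ha hu; exact: (act_deg ha hu). Qed.

Lemma sub_act_sum : direct_sum (fun i => [set v | exists w, v = sub_act (lid A i) w]).
Proof.
split; last first.
  exact: act_independent sub_act_linl sub_act_linr sub_actA (lid_idem A) (@lid_orth _ _ A).
move=> u; have [r hr] := gmod_dec (subsp_val u).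
have -> : u = \sum_(i <- r) sub_act (lid A i) u.
  apply: subsp_inj; rewrite (linear_sumf _ _ (@subsp_val_linear _ _ N)).
  exact: hr.
apply: is_subspace_sum.
  apply: isum_subspace => i; split; first by exists 0; rewrite (linear0f (sub_act_linr _)).
  by move=> c _ _ [x ->] [w ->]; exists (c *: x + w); rewrite sub_act_linr.
by move=> i _; apply: (isum1 (j := i)); exists u.
Qed.

Definition sub_gmod : gmod A :=
  GMod sub_act_linl sub_act_linr sub_actA sub_act_deg sub_act_sum.

Definition quo_act (a : A) (u : gquo N) : gquo N := quo_pi N (act a (quo_repr u)).

Lemma quo_actE a v : quo_act a (quo_pi N v) = quo_pi N (act a v).
Proof.
apply/quo_piP; rewrite -scaleN1r addrC -act_linr; apply: gsubmodP.
by rewrite scaleN1r addrC; apply/quo_piP; rewrite quo_reprK.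
Qed.

Lemma quo_act_linl u : linear (fun a => quo_act a u).
Proof.
move=> c a b; rewrite -[u]quo_reprK !quo_actE -quo_pi_linear.
by rewrite act_linl.
Qed.

Lemma quo_act_linr a : linear (quo_act a).
Proof.
move=> c u v; rewrite -[u]quo_reprK -[v]quo_reprK -quo_pi_linear !quo_actE.
by rewrite -quo_pi_linear act_linr.
Qed.

Lemma quo_actA a b u : quo_act (lmul a b) u = quo_act a (quo_act b u).
Proof. by rewrite -[u]quo_reprK !quo_actE actA. Qed.

Lemma quo_act_deg d e a u : gdeg d a -> gdeg e u -> gdeg (d + e) (quo_act a u).
Proof.
move=> ha [v hv <-]; rewrite quo_actE; exists (act a v) => //.
exact: act_deg.
Qed.

Lemma quo_act_sum : direct_sum (fun i => [set v | exists w, v = quo_act (lid A i) w]).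
Proof.
split; last first.
  exact: act_independent quo_act_linl quo_act_linr quo_actA (lid_idem A) (@lid_orth _ _ A).
move=> u; rewrite -[u]quo_reprK.
apply: (isum_morph (@quo_pi_linear _ _ N) _ _ ((act_sum V).1 _)).
  move=> i; split; first by exists 0; rewrite (linear0f (quo_act_linr _)).
  by move=> c _ _ [x ->] [w ->]; exists (c *: x + w); rewrite quo_act_linr.
move=> i _ [w ->]; apply: (isum1 (j := i)); exists (quo_pi N w).
by rewrite quo_actE.
Qed.

Definition quo_gmod : gmod A :=
  GMod quo_act_linl quo_act_linr quo_actA quo_act_deg quo_act_sum.

End SubQuotient.

Section ShiftModule.
Context V (n : int).

Lemma shift_act_deg d e a (v : gshift V n) :
  gdeg d a -> gdeg e v -> gdeg (d + e) (act a v : gshift V n).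
Proof. by move=> ha hv; rewrite /= -addrA; exact: act_deg. Qed.

Definition shift : gmod A :=
  @GMod _ _ A (gshift V n) (@act _ _ _ V) (@act_linl _ _ _ V) (@act_linr _ _ _ V)
    (@actA _ _ _ V) shift_act_deg (act_sum V).
End ShiftModule.

Definition full_irreducibles (T : Type) (L : T -> gmod A) : Prop :=
  (forall b, irreducible (L b)) /\
  forall V, irreducible V -> exists! b, exists n, iso V (shift (L b) n).

Definition projective V : Prop :=
  forall (M N : gmod A) (g : M -> N) (f : V -> N),
    is_hom 0 g -> (forall y, exists x, g x = y) -> is_hom 0 f ->
    exists h : V -> M, is_hom 0 h /\ forall v, g (h v) = f v.

Definition injective_gmod V : Prop :=
  forall (M N : gmod A) (g : N -> M) (f : N -> V),
    is_hom 0 g -> injective g -> is_hom 0 f ->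
    exists h : M -> V, is_hom 0 h /\ forall x, h (g x) = f x.

Definition projective_cover (V L : gmod A) : Prop :=
  projective V /\
  exists p : V -> L, [/\ is_hom 0 p, forall y, exists x, p x = y &
    forall N : gsubmod V, (forall y, exists2 x, N x & p x = y) -> forall v, N v].

Definition injective_hull (V L : gmod A) : Prop :=
  injective_gmod V /\
  exists i : L -> V, [/\ is_hom 0 i, injective i &
    forall N : gsubmod V, (exists2 v, N v & v <> 0) -> exists2 x, N (i x) & x <> 0].

Definition unique_irreducible_quotient (V L : gmod A) : Prop :=
  exists N : gsubmod V, [/\ irreducible (quo_gmod N), iso L (quo_gmod N) &
    forall N' : gsubmod V, irreducible (quo_gmod N') -> forall v, N' v <-> N v].

Definition unique_irreducible_submodule (V L : gmod A) : Prop :=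
  exists N : gsubmod V, [/\ irreducible (sub_gmod N), iso L (sub_gmod N) &
    forall N' : gsubmod V, irreducible (sub_gmod N') -> forall v, N' v <-> N v].

End Modules.

Section Corner.
Context (K : fieldType) (I : choiceType) (A : lualg K I).

Record hidem := HIdem {
  hidem_val : A;
  hidem_homog : homogeneous hidem_val;
  hidem_idem : lmul hidem_val hidem_val = hidem_val
}.

Context (e : hidem).
Local Notation ev := (hidem_val e).
Implicit Types a : A.

Lemma hidem_deg0 : gdeg 0 ev.
Proof. by apply: idem_deg0; [exact: hidem_homog|exact: hidem_idem]. Qed.

Lemma left_deg d a : gdeg d a -> gdeg d (lmul ev a).
Proof. by move=> ha; rewrite -[d]add0r; exact: lmul_deg hidem_deg0 ha. Qed.

Lemma right_deg d a : gdeg d a -> gdeg d (lmul a ev).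
Proof. by move=> ha; rewrite -[d]addr0; exact: lmul_deg ha hidem_deg0. Qed.

Lemma corner_linear : linear (fun a => lmul (lmul ev a) ev).
Proof. by move=> c u v; rewrite lmul_linr lmul_linl. Qed.

Lemma corner_deg d a : gdeg d a -> gdeg d (lmul (lmul ev a) ev).
Proof. by move=> ha; exact: right_deg (left_deg ha). Qed.

Definition eAe : gsubspace A := gimage corner_linear corner_deg.
Definition Ae : gsubspace A := gimage (lmul_linl ev) right_deg.
Definition eA : gsubspace A := gimage (lmul_linr ev) left_deg.

Lemma AeP (x : A) : Ae x <-> lmul x ev = x.
Proof.
split=> [[b _ <-]|h]; last by exists x.
by rewrite -lmulA hidem_idem.
Qed.

Lemma eAP (x : A) : eA x <-> lmul ev x = x.
Proof.
split=> [[b _ <-]|h]; last by exists x.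
by rewrite lmulA hidem_idem.
Qed.

Lemma eAeP (x : A) : eAe x <-> Ae x /\ eA x.
Proof.
rewrite AeP eAP; split=> [[b _ <-]|[h h']]; last by exists x => //; rewrite h' h.
by rewrite -lmulA hidem_idem !lmulA hidem_idem.
Qed.

Lemma Ae_l a x : Ae x -> Ae (lmul a x).
Proof. by rewrite !AeP -lmulA => ->. Qed.

Lemma eA_r a x : eA x -> eA (lmul x a).
Proof. by rewrite !eAP lmulA => ->. Qed.

Lemma eAe_mul x y : eAe x -> eAe y -> eAe (lmul x y).
Proof. by rewrite !eAeP => -[_ h] [h' _]; split; [exact: Ae_l|exact: eA_r]. Qed.

Definition corner_mul (x y : gsub eAe) : gsub eAe :=
  subsp_of (eAe_mul (subspP x) (subspP y)).

Lemma corner_linl y : linear (fun x => corner_mul x y).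
Proof.
move=> c u v; apply: subsp_inj; rewrite [RHS]subsp_val_linear.
rewrite -[LHS]/(lmul (subsp_val (c *: u + v)) (subsp_val y)) subsp_val_linear.
exact: lmul_linl.
Qed.

Lemma corner_linr x : linear (corner_mul x).
Proof.
move=> c u v; apply: subsp_inj; rewrite [RHS]subsp_val_linear.
rewrite -[LHS]/(lmul (subsp_val x) (subsp_val (c *: u + v))) subsp_val_linear.
exact: lmul_linr.
Qed.

Lemma corner_mulA x y z :
  corner_mul x (corner_mul y z) = corner_mul (corner_mul x y) z.
Proof. by apply: subsp_inj; exact: lmulA. Qed.

Lemma corner_mul_deg d f x y :
  gdeg d x -> gdeg f y -> gdeg (d + f) (corner_mul x y).
Proof. by move=> hx hy; exact: (lmul_deg hx hy). Qed.

Lemma eAe_e : eAe ev.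
Proof. by exists ev => //; rewrite !hidem_idem. Qed.

Definition corner_one (_ : unit) : gsub eAe := subsp_of eAe_e.

Lemma corner_one_homog i : homogeneous (corner_one i).
Proof. by exists 0; exact: hidem_deg0. Qed.

Lemma corner_one_idem i : corner_mul (corner_one i) (corner_one i) = corner_one i.
Proof. by apply: subsp_inj; exact: hidem_idem. Qed.

Lemma corner_one_orth i j : i <> j -> corner_mul (corner_one i) (corner_one j) = 0.
Proof. by case: i; case: j. Qed.

Lemma corner_one_sum : direct_sum (fun ij : unit * unit => [set a | exists b,
  a = corner_mul (corner_mul (corner_one ij.1) b) (corner_one ij.2)]).
Proof.
split; last exact: peirce_independent corner_linl corner_linr corner_mulA
  corner_one_idem corner_one_orth.
move=> x; apply: (isum1 (j := (tt, tt))); exists x; apply: subsp_inj => /=.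
by have /eAeP[/AeP h /eAP h'] := subspP x; rewrite h' h.
Qed.

(* A unital graded algebra is a locally unital one with a single idempotent. *)
Definition corner : lualg K unit :=
  LUAlg corner_linl corner_linr corner_mulA corner_mul_deg corner_one_homog
    corner_one_idem corner_one_orth corner_one_sum.

Definition Ae_lact (a : A) (x : gsub Ae) : gsub Ae := subsp_of (Ae_l a (subspP x)).

Lemma Ae_r x b : Ae x -> eAe b -> Ae (lmul x b).
Proof. by move=> _ /eAeP[h _]; exact: Ae_l. Qed.

Definition Ae_ract (x : gsub Ae) (b : corner) : gsub Ae :=
  subsp_of (Ae_r (subspP x) (subspP b)).

Definition eA_ract (x : gsub eA) (a : A) : gsub eA := subsp_of (eA_r a (subspP x)).

Lemma eA_l b x : eAe b -> eA x -> eA (lmul b x).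
Proof. by move=> /eAeP[_ h] _; exact: eA_r. Qed.

Definition eA_lact (b : corner) (x : gsub eA) : gsub eA :=
  subsp_of (eA_l (subspP b) (subspP x)).

Lemma Ae_lact_linl x : linear (fun a => Ae_lact a x).
Proof.
move=> c u v; apply: subsp_inj; rewrite [RHS]subsp_val_linear; exact: lmul_linl.
Qed.
Lemma Ae_lact_linr a : linear (Ae_lact a).
Proof.
move=> c u v; apply: subsp_inj; rewrite [RHS]subsp_val_linear.
rewrite -[LHS]/(lmul a (subsp_val (c *: u + v))) subsp_val_linear.
exact: lmul_linr.
Qed.
Lemma Ae_ract_linl b : linear (fun x => Ae_ract x b).
Proof.
move=> c u v; apply: subsp_inj; rewrite [RHS]subsp_val_linear.
rewrite -[LHS]/(lmul (subsp_val (c *: u + v)) (subsp_val b)) subsp_val_linear.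
exact: lmul_linl.
Qed.
Lemma Ae_ract_linr x : linear (Ae_ract x).
Proof.
move=> c u v; apply: subsp_inj; rewrite [RHS]subsp_val_linear.
rewrite -[LHS]/(lmul (subsp_val x) (subsp_val (c *: u + v))) subsp_val_linear.
exact: lmul_linr.
Qed.
Lemma eA_lact_linl x : linear (fun b => eA_lact b x).
Proof.
move=> c u v; apply: subsp_inj; rewrite [RHS]subsp_val_linear.
rewrite -[LHS]/(lmul (subsp_val (c *: u + v)) (subsp_val x)) subsp_val_linear.
exact: lmul_linl.
Qed.
Lemma eA_lact_linr b : linear (eA_lact b).
Proof.
move=> c u v; apply: subsp_inj; rewrite [RHS]subsp_val_linear.
rewrite -[LHS]/(lmul (subsp_val b) (subsp_val (c *: u + v))) subsp_val_linear.
exact: lmul_linr.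
Qed.
Lemma eA_ract_linl a : linear (fun x => eA_ract x a).
Proof.
move=> c u v; apply: subsp_inj; rewrite [RHS]subsp_val_linear.
rewrite -[LHS]/(lmul (subsp_val (c *: u + v)) a) subsp_val_linear.
exact: lmul_linl.
Qed.
Lemma eA_ract_linr x : linear (eA_ract x).
Proof.
move=> c u v; apply: subsp_inj; rewrite [RHS]subsp_val_linear; exact: lmul_linr.
Qed.

End Corner.

Section FreeModule.
Context (K : fieldType) (X : choiceType).
Local Notation F := {freeg X / K}.

Lemma freegU_scale (k : K) (x : X) : << k *g x >> = k *: (<< x >> : F).
Proof. by apply/eqP/freeg_eqP => y; rewrite coeffZ !coeffU mul1r. Qed.

Lemma freeg_ind (W : set F) : is_subspace W -> (forall x, W << x >>) -> forall D, W D.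
Proof.
move=> hW h D; rewrite -[D]freeg_sumE; apply: is_subspace_sum => // x _.
by rewrite freegU_scale; apply: is_subspaceZ.
Qed.

Lemma fglift_linear (M : lmodType K) (f : X -> M) : linear (fglift f).
Proof.
have hD : {morph fglift f : u v / u + v}.
  move=> u v; have /= h := lift_is_additive f.
  have h0 : fglift f 0 = 0 by rewrite -(subrr 0) h subrr.
  by rewrite -[v in LHS]opprK h -[- v]sub0r h h0 sub0r opprK.
have h0 : fglift f 0 = 0.
  by rewrite -(subrr 0) (lift_is_additive f) subrr.
move=> c u v; rewrite hD; congr (_ + _).
rewrite -[u]freeg_sumE scaler_sumr !(big_morph _ hD h0) scaler_sumr.
apply: eq_bigr => x _; set k := coeff x u.
have -> : c *: (<< k *g x >> : F) = << (c * k) *g x >>.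
  by rewrite [RHS]freegU_scale -scalerA -freegU_scale.
by rewrite !liftU scalerA.
Qed.
End FreeModule.

Section Tensor.
Context (K : fieldType) (I : choiceType) (A : lualg K I) (e : hidem A).
Context (P : gmod (corner e)).
Local Notation M := (gsub (Ae e)).
Local Notation F := {freeg (M * P)%type / K}.

Definition tensor_gen (x : M) (p : P) : F := << (x, p) >>.

Definition tensor_rel : set F :=
  [set z | exists c x x' p, z = tensor_gen (c *: x + x') p -
     (c *: tensor_gen x p + tensor_gen x' p)] `|`
  [set z | exists c x p p', z = tensor_gen x (c *: p + p') -
     (c *: tensor_gen x p + tensor_gen x p')] `|`
  [set z | exists x b p, z = tensor_gen (Ae_ract x b) p - tensor_gen x (act b p)].

Definition tensor_ker : subspace F := Subspace (span_subspace tensor_rel).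
Definition tensor_space : lmodType K := quosp tensor_ker.
Local Notation T := tensor_space.
Definition tens (x : M) (p : P) : T := quo_pi tensor_ker (tensor_gen x p).

Lemma tens_linl p : linear (fun x => tens x p).
Proof.
move=> c u v; rewrite /tens -quo_pi_linear; apply/quo_piP.
by apply: span_gen; left; left; exists c, u, v, p.
Qed.

Lemma tens_linr x : linear (tens x).
Proof.
move=> c u v; rewrite /tens -quo_pi_linear; apply/quo_piP.
by apply: span_gen; left; right; exists c, x, u, v.
Qed.

Lemma tens_bal x b p : tens (Ae_ract x b) p = tens x (act b p).
Proof. by apply/quo_piP; apply: span_gen; right; exists x, b, p. Qed.

Lemma tens_ind (W : set T) : is_subspace W -> (forall x p, W (tens x p)) ->
  forall t, W t.
Proof.
move=> hW h t; rewrite -[t]quo_reprK.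
apply: (@freeg_ind K _ [set z : F | W (quo_pi tensor_ker z)]) => [|[x p]].
  exact: (@linear_preimage K F T (quo_pi tensor_ker) W (@quo_pi_linear _ _ _)).
exact: h.
Qed.

Section Lift.
Context (U : lmodType K) (f : M -> P -> U).
Context (fl : forall p, linear (fun x => f x p)) (fr : forall x, linear (f x)).
Context (fb : forall x b p, f (Ae_ract x b) p = f x (act b p)).

Let f' : F -> U := fglift (fun z => f z.1 z.2).

Let f'_gen x p : f' (tensor_gen x p) = f x p.
Proof. by rewrite /f' liftU scale1r. Qed.

Let f'_lin : linear f'. Proof. exact: fglift_linear. Qed.

Let f'_B u v : f' u = f' v -> f' (u - v) = 0.
Proof.
by move=> h; rewrite addrC -scaleN1r f'_lin h scaleN1r addNr.
Qed.

Let f'_ker z : tensor_ker z -> f' z = 0.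
Proof.
apply: (@span_ind _ F tensor_rel [set z | f' z = 0]).
  split; first exact: linear0f f'_lin.
  by move=> c u v hu hv /=; rewrite f'_lin hu hv scaler0 addr0.
move=> _ [[[c [x [x' [p ->]]]]|[c [x [p [p' ->]]]]]|[x [b [p ->]]]];
  apply: f'_B; rewrite ?f'_lin !f'_gen; [exact: fl|exact: fr|exact: fb].
Qed.

Definition tensor_lift : T -> U := quo_lift f'.

Lemma tensor_lift_linear : linear tensor_lift.
Proof. exact: quo_lift_linear f'_lin f'_ker. Qed.

Lemma tensor_liftE x p : tensor_lift (tens x p) = f x p.
Proof. by rewrite /tensor_lift (quo_liftE f'_lin f'_ker) f'_gen. Qed.
End Lift.

Definition tensor_deg (d : int) : set T := span
  [set t | exists m n (x : M) (p : P),
     [/\ m + n = d, gdeg m x, gdeg n p & t = tens x p]].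

Lemma tens0l p : tens 0 p = 0. Proof. exact: linear0f (tens_linl p). Qed.
Lemma tens0r x : tens x 0 = 0. Proof. exact: linear0f (tens_linr x). Qed.

Lemma eq_subspace (U V : lmodType K) (f g : U -> V) :
  linear f -> linear g -> is_subspace [set x | f x = g x].
Proof.
move=> lf lg; split; first by rewrite /= (linear0f lf) (linear0f lg).
by move=> c u v hu hv /=; rewrite lf lg hu hv.
Qed.

Section Projection.
Context (d : int).

Let csup (x : M) := csupp (gdeg_sum M) x.

Let phi (x : M) (p : P) : T :=
  \sum_(k <- csup x) tens (gcomp k x) (gcomp (d - k) p).

Let phiE x p t : uniq t -> {subset csup x <= t} ->
  phi x p = \sum_(k <- t) tens (gcomp k x) (gcomp (d - k) p).
Proof.
move=> ut st; rewrite /phi -(big_ext _ _ ut st); last exact: csupp_uniq.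
apply: eq_bigr => k _; case: ifPn => // hk.
by rewrite [gcomp k x]icomp_out // tens0l.
Qed.

Let phi_linl p : linear (fun x => phi x p).
Proof.
move=> c u v; pose t := undup (csup u ++ csup v ++ csup (c *: u + v)).
have ut : uniq t by exact: undup_uniq.
rewrite !(@phiE _ _ t) //;
  try by move=> k hk; rewrite mem_undup !mem_cat hk ?orbT.
rewrite scaler_sumr -big_split /=; apply: eq_bigr => k _.
by rewrite gcomp_linear tens_linl.
Qed.

Let phi_linr x : linear (phi x).
Proof.
move=> c u v; rewrite /phi scaler_sumr -big_split /=; apply: eq_bigr => k _.
by rewrite gcomp_linear tens_linr.
Qed.

Let phi_hom m n x p : gdeg m x -> gdeg n p ->
  phi x p = if m + n == d then tens x p else 0.
Proof.
move=> hx hp; rewrite (@phiE _ _ (undup (m :: csup x))) ?undup_uniq //; last first.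
  by move=> k hk; rewrite mem_undup inE hk orbT.
rewrite (bigD1_seq m) ?mem_undup ?inE ?eqxx ?undup_uniq //= big1 ?addr0.
  rewrite (gcomp_id hx); case: ifPn => h.
    by rewrite -(eqP h) addrC addKr (gcomp_id hp).
  rewrite (@gcomp_ne _ _ _ n) ?tens0r //; apply: contra h => /eqP <-.
  by rewrite addrC subrK.
by move=> k km; rewrite (gcomp_ne km hx) tens0l.
Qed.

Let phi_bal x b p : phi (Ae_ract x b) p = phi x (act b p).
Proof.
apply: (@gspace_ind _ M [set x | phi (Ae_ract x b) p = phi x (act b p)]).
  apply: (@eq_subspace M T (fun x => phi (Ae_ract x b) p)).
    by move=> c u v; rewrite Ae_ract_linl phi_linl.
  exact: phi_linl.
move=> m {}x hx /=.
apply: (@gspace_ind _ (corner e) [set b | phi (Ae_ract x b) p = phi x (act b p)]).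
  apply: (@eq_subspace (corner e) T (fun b => phi (Ae_ract x b) p)).
    by move=> c u v; rewrite (Ae_ract_linr x c u v) phi_linl.
  by move=> c u v; rewrite (act_linl p c u v) phi_linr.
move=> n {}b hb /=.
apply: (@gspace_ind _ P [set p | phi (Ae_ract x b) p = phi x (act b p)]).
  apply: (@eq_subspace P T); first exact: phi_linr.
  by move=> c u v; rewrite act_linr phi_linr.
move=> l {}p hp /=.
have hxb : gdeg (m + n) (Ae_ract x b) by exact: (lmul_deg hx hb).
rewrite (phi_hom hxb hp) (phi_hom hx (act_deg hb hp)) addrA.
by rewrite tens_bal.
Qed.

Definition tensor_proj : T -> T := tensor_lift phi.

Lemma tensor_proj_linear : linear tensor_proj.
Proof. exact: tensor_lift_linear phi_linl phi_linr phi_bal. Qed.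

Lemma tensor_proj_hom m n x p : gdeg m x -> gdeg n p ->
  tensor_proj (tens x p) = if m + n == d then tens x p else 0.
Proof.
move=> hx hp; rewrite /tensor_proj (tensor_liftE phi_linl phi_linr phi_bal).
exact: phi_hom.
Qed.
End Projection.

Lemma tensor_deg_subspace d : is_subspace (tensor_deg d).
Proof. exact: span_subspace. Qed.

Lemma tensor_deg_sum : direct_sum tensor_deg.
Proof.
split.
  have hW := isum_subspace tensor_deg_subspace.
  apply: (tens_ind hW) => x p.
  apply: (@gspace_ind _ M [set x | isum tensor_deg (tens x p)]).
    exact: (@linear_preimage _ M T (fun x => tens x p) _ (tens_linl p) hW).
  move=> m {}x hx /=.
  apply: (@gspace_ind _ P [set p | isum tensor_deg (tens x p)]).
    exact: (@linear_preimage _ P T (tens x) _ (tens_linr x) hW).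
  move=> n {}p hp; apply: (isum1 (j := m + n)); apply: span_gen.
  by exists m, n, x, p.
apply: (@independent_proj _ _ _ _ tensor_proj) => [d|d|d k].
- exact: tensor_proj_linear.
- apply: (@span_ind _ T _ [set v | tensor_proj d v = v]).
    by apply: (@eq_subspace T T (tensor_proj d) id) => //; exact: tensor_proj_linear.
  move=> _ [m [n [x [p [mn hx hp ->]]]]] /=.
  by rewrite (tensor_proj_hom _ hx hp) mn eqxx.
- move=> v dk; move: v.
  apply: (@span_ind _ T _ [set v | tensor_proj d v = 0]).
    apply: (@eq_subspace T T (tensor_proj d) (fun=> 0)); first exact: tensor_proj_linear.
    by move=> c u v; rewrite scaler0 addr0.
  move=> _ [m [n [x [p [mn hx hp ->]]]]] /=.
  by rewrite (tensor_proj_hom _ hx hp) mn eq_sym (negPf dk).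
Qed.

Definition tensor_gspace : gspace K := GSpace tensor_deg_subspace tensor_deg_sum.

Definition tensor_act (a : A) : tensor_gspace -> tensor_gspace :=
  tensor_lift (fun x p => tens (Ae_lact a x) p).

Let fl a p : linear (fun x => tens (Ae_lact a x) p).
Proof. by move=> c u v; rewrite Ae_lact_linr tens_linl. Qed.
Let fr a x : linear (fun p => tens (Ae_lact a x) p).
Proof. exact: tens_linr. Qed.
Let fb a x b p : tens (Ae_lact a (Ae_ract x b)) p = tens (Ae_lact a x) (act b p).
Proof.
rewrite -tens_bal; congr tens; apply: subsp_inj; exact: lmulA.
Qed.

Lemma tensor_act_linr a : linear (tensor_act a).
Proof. exact: tensor_lift_linear (fl a) (fr a) (fb a). Qed.

Lemma tensor_actE a x p : tensor_act a (tens x p) = tens (Ae_lact a x) p.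
Proof. exact: tensor_liftE (fl a) (fr a) (fb a) _ _. Qed.

Lemma tensor_act_linl t : linear (fun a => tensor_act a t).
Proof.
move=> c a b; move: t.
apply: (@tens_ind [set t | tensor_act (c *: a + b) t =
  c *: tensor_act a t + tensor_act b t]).
  apply: (@eq_subspace T T); first exact: tensor_act_linr.
  move=> k u v; rewrite !tensor_act_linr !scalerDr !scalerA [c * k]mulrC.
  by rewrite addrACA.
by move=> x p /=; rewrite !tensor_actE Ae_lact_linl tens_linl.
Qed.

Lemma tensor_actA a b t :
  tensor_act (lmul a b) t = tensor_act a (tensor_act b t).
Proof.
move: t; apply: (@tens_ind [set t | tensor_act (lmul a b) t =
  tensor_act a (tensor_act b t)]).
  apply: (@eq_subspace T T); first exact: tensor_act_linr.
  by move=> k u v; rewrite !tensor_act_linr.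
move=> x p /=; rewrite !tensor_actE; congr tens; apply: subsp_inj.
by rewrite /= lmulA.
Qed.

Lemma tensor_act_deg d f a (t : tensor_gspace) :
  gdeg d a -> gdeg f t -> gdeg (d + f) (tensor_act a t).
Proof.
move=> ha; apply: (@span_ind _ T _ [set t | tensor_deg (d + f) (tensor_act a t)]).
  exact: (@linear_preimage _ T T (tensor_act a) _ (tensor_act_linr a)
    (tensor_deg_subspace _)).
move=> _ [m [n [x [p [mn hx hp ->]]]]] /=; rewrite tensor_actE.
apply: span_gen; exists (d + m), n, (Ae_lact a x), p; split=> //.
  by rewrite -addrA mn.
exact: (lmul_deg ha hx).
Qed.

Lemma tensor_act_sum : direct_sum (fun i : I =>
  [set v | exists w, v = tensor_act (lid A i) w]).
Proof.
split; last first.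
  exact: act_independent tensor_act_linl tensor_act_linr tensor_actA
    (lid_idem A) (@lid_orth _ _ A).
have hW : is_subspace (isum (fun i : I =>
    [set v | exists w, v = tensor_act (lid A i) w])).
  apply: isum_subspace => i; split; first by exists 0; rewrite (linear0f (tensor_act_linr _)).
  by move=> c _ _ [x ->] [w ->]; exists (c *: x + w); rewrite tensor_act_linr.
apply: (tens_ind hW) => x p.
have [b _ hb] := subspP x.
have hA a : Ae e (lmul a (hidem_val e)) by exists a.
have -> : x = subsp_of (hA b) by exact: subsp_inj.
pose g a : T := tens (subsp_of (hA a) : M) p.
have lg : linear g.
  move=> c u v; rewrite /g -tens_linl; congr tens; apply: subsp_inj.
  by rewrite [RHS]subsp_val_linear /=; exact: lmul_linl.
apply: (@peirce_ind _ _ A [set a | isum _ (g a)]).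
  exact: (@linear_preimage _ A T g _ lg hW).
move=> i j d c _; apply: (isum1 (j := i)).
exists (g (lmul c (lid A j))); rewrite /g tensor_actE; congr tens.
by apply: subsp_inj; rewrite /= !lmulA.
Qed.

(* The A-module Ae (x)_{eAe} P *)
Definition jshriek : gmod A :=
  @GMod _ _ A tensor_gspace tensor_act tensor_act_linl tensor_act_linr tensor_actA
    tensor_act_deg tensor_act_sum.

End Tensor.

Section Coinduction.
Context (K : fieldType) (I : choiceType) (A : lualg K I) (e : hidem A).
Context (Q : gmod (corner e)).
Local Notation E := (gsub (eA e)).

(* Hom_{eAe}(eA1_i, Q)_d, with eA1_i regarded as a direct summand of eA: its
   elements are the homomorphisms eA -> Q killing eA1_j for all j <> i. *)
Definition coind_hom (id : I * int) : set (E -> Q) := [set f |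
  [/\ linear f,
      forall b x, f (eA_lact b x) = act b (f x),
      forall n x, gdeg n x -> gdeg (n + id.2) (f x) &
      forall j x, j <> id.1 -> f (eA_ract x (lid A j)) = 0]].

Lemma fct_scale_addE (c : K) (f g : E -> Q) x : (c *: f + g) x = c *: f x + g x.
Proof. by []. Qed.

Lemma coind_hom_subspace id : is_subspace (coind_hom id).
Proof.
split.
  split=> [c u v|b x|n x _|j x _] //.
  - by rewrite -[LHS]/(0 : Q) -[_ u]/(0 : Q) -[_ v]/(0 : Q) scaler0 addr0.
  - by rewrite -[LHS]/(0 : Q) -[_ x]/(0 : Q) act0r.
  - exact: (gdegS Q _).1.
move=> c f g [lf bf df f0] [lg bg dg g0]; split=> [k u v|b x|n x hx|j x hj].
- rewrite !fct_scale_addE lf lg !scalerDr !scalerA [c * k]mulrC.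
  by rewrite addrACA.
- by rewrite !fct_scale_addE bf bg act_linr.
- by rewrite fct_scale_addE; apply: (gdegS Q _).2; [exact: df|exact: dg].
- by rewrite fct_scale_addE f0 // g0 // scaler0 addr0.
Qed.

Definition coind_subspace : subspace (E -> Q) :=
  Subspace (isum_subspace coind_hom_subspace).
Definition coind_space : lmodType K := subsp coind_subspace.
Local Notation C := coind_space.

Definition coind_deg (d : int) : set C :=
  [set u | isum (fun i => coind_hom (i, d)) (subsp_val u)].

Lemma coind_deg_subspace d : is_subspace (coind_deg d).
Proof.
apply: (@linear_preimage _ C (E -> Q) (@subsp_val _ _ coind_subspace)
  (isum (fun i => coind_hom (i, d)))); first exact: subsp_val_linear.
by apply: isum_subspace => i; exact: coind_hom_subspace.
Qed.

Lemma coind_degP d u : coind_deg d u ->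
  linear (subsp_val u) /\ forall n x, gdeg n x -> gdeg (n + d) (subsp_val u x).
Proof.
pose W := [set f : E -> Q | linear f /\ forall n x, gdeg n x -> gdeg (n + d) (f x)].
apply: (@isum_ind _ _ _ _ W) => [|i f [lf _ df _]]; last by split.
split.
  split=> [c u' v|n x _]; last exact: (gdegS Q _).1.
  by rewrite -[LHS]/(0 : Q) -[_ u']/(0 : Q) -[_ v]/(0 : Q) scaler0 addr0.
move=> c f g [lf df] [lg dg]; split=> [k u' v|n x hx].
  by rewrite !fct_scale_addE lf lg !scalerDr !scalerA [c * k]mulrC addrACA.
by rewrite fct_scale_addE; apply: (gdegS Q _).2; [exact: df|exact: dg].
Qed.

Lemma coind_lift (W : set C) : is_subspace W ->
  (forall id f (h : coind_subspace f), coind_hom id f -> W (subsp_of h)) ->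
  forall u, W u.
Proof.
move=> hW h u.
pose W' := [set f : E -> Q | exists u : C, subsp_val u = f /\ W u].
suff : W' (subsp_val u) by case=> u' [/subsp_inj ->].
apply: (@isum_ind _ _ _ coind_hom W' _ _ _ (subspP u)).
  split; first by exists 0; split; [exact: linear0f (@subsp_val_linear _ _ coind_subspace)|exact: hW.1].
  move=> c _ _ [u1 [<- h1]] [u2 [<- h2]]; exists (c *: u1 + u2).
  by split; [exact: subsp_val_linear|exact: hW.2].
move=> id f hf; have hC : coind_subspace f by exact: (isum1 (j := id)).
by exists (subsp_of hC); split=> //; exact: h hf.
Qed.

Lemma coind_deg_sum : direct_sum coind_deg.
Proof.
split.
  apply: (coind_lift (isum_subspace coind_deg_subspace)) => -[i d] f h hf.
  by apply: (isum1 (j := d)); apply: (isum1 (j := i)).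
move=> r f ur hf s0 j jr; apply: subsp_inj.
rewrite (linear0f (@subsp_val_linear _ _ coind_subspace)); apply: funext => x.
apply: (@gspace_ind _ E [set x | subsp_val (f j) x = 0]) => [|n {}x hx /=].
  have [l _] := coind_degP (hf j jr).
  split; first exact: linear0f l.
  by move=> c u v hu hv /=; rewrite l hu hv scaler0 addr0.
have hs : \sum_(k <- r) subsp_val (f k) x = 0.
  have : subsp_val (\sum_(k <- r) f k) x = 0 by rewrite s0.
  rewrite (linear_sumf _ _ (@subsp_val_linear _ _ coind_subspace)).
  suff -> : forall t, (\sum_(k <- t) subsp_val (f k)) x =
    \sum_(k <- t) subsp_val (f k) x by [].
  elim=> [|k t IH]; first by rewrite !big_nil.
  by rewrite !big_cons -IH.
have dQ := (shift_deg_sum Q n).2.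
apply: (dQ r (fun k => subsp_val (f k) x) ur _ hs j jr) => k kr.
by rewrite addrC; exact: (coind_degP (hf k kr)).2.
Qed.

Definition coind_gspace : gspace K := GSpace coind_deg_subspace coind_deg_sum.

Definition coind_fun (a : A) (f : E -> Q) : E -> Q := fun x => f (eA_ract x a).

Lemma coind_fun_linr a : linear (coind_fun a). Proof. by []. Qed.

Lemma eA_ract_peirce_hom i d f j k m b : coind_hom (i, d) f -> gdeg m b ->
  coind_hom (j, m + d) (coind_fun (lmul (lmul (lid A j) b) (lid A k)) f).
Proof.
move=> [lf bf df f0] hb; set a := lmul _ _.
have ha : gdeg m a.
  rewrite -[m]addr0; apply: lmul_deg; last exact: lid_deg0.
  by rewrite -[m]add0r; apply: lmul_deg => //; exact: lid_deg0.
split=> [c u v|b' x|n x hx|l x /= lj]; rewrite /coind_fun.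
- by rewrite eA_ract_linl lf.
- by rewrite -bf; congr f; apply: subsp_inj; rewrite /= lmulA.
- by rewrite /= addrA; apply: df; exact: (lmul_deg hx ha).
- suff -> : eA_ract (eA_ract x (lid A l)) a = 0 by exact: linear0f lf.
  apply: subsp_inj; rewrite [RHS](linear0f (@subsp_val_linear _ _ _)) /= /a.
  by rewrite -lmulA [lmul (lid A l) _]lmulA [lmul (lid A l) _]lmulA lid_orth // !lmul0l lmul0r.
Qed.

Lemma coind_fun_linl u c a b : coind_subspace u ->
  coind_fun (c *: a + b) u = c *: coind_fun a u + coind_fun b u.
Proof.
move=> hu; apply: funext => x; rewrite fct_scale_addE /coind_fun eA_ract_linr.
pose W := [set f : E -> Q | linear f].
have : W u; last exact.
apply: (@isum_ind _ _ _ coind_hom W _ _ _ hu); last by move=> id f [].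
split; first by move=> k v w; rewrite -[LHS]/(0 : Q) -[_ v]/(0 : Q) -[_ w]/(0 : Q) scaler0 addr0.
move=> k f g lf lg t v w.
by rewrite !fct_scale_addE lf lg !scalerDr !scalerA [k * t]mulrC addrACA.
Qed.

Lemma coind_fun_deg m a f d : gdeg m a -> isum (fun i => coind_hom (i, d)) f ->
  isum (fun i => coind_hom (i, m + d)) (coind_fun a f).
Proof.
move=> ha hf.
have hf' : coind_subspace f.
  apply: (@isum_ind _ _ _ _ coind_subspace _ _ _ hf); first exact: subspaceP.
  by move=> i g hg; exact: (isum1 (j := (i, d))).
have hW k : is_subspace (isum (fun i => coind_hom (i, k))).
  by apply: isum_subspace => i; exact: coind_hom_subspace.
suff : forall a, isum (fun i => coind_hom (i, m + d)) (coind_fun (gcomp m a) f).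
  by move=> /(_ a); rewrite (gcomp_id ha).
move=> {ha}a; move: a.
apply: (@peirce_ind _ _ A [set a | isum (fun i => coind_hom (i, m + d))
    (coind_fun (gcomp m a) f)]).
  apply: (@linear_preimage _ A (E -> Q) (fun a => coind_fun (gcomp m a) f)) => //.
  by move=> c u v; rewrite gcomp_linear coind_fun_linl.
move=> j k n b hb /=.
have hjk : gdeg n (lmul (lmul (lid A j) b) (lid A k)).
  rewrite -[n]addr0; apply: lmul_deg; last exact: lid_deg0.
  by rewrite -[n]add0r; apply: lmul_deg => //; exact: lid_deg0.
have [nm|nm] := eqVneq m n; last first.
  rewrite (gcomp_ne nm hjk).
  have -> : coind_fun 0 f = 0.
    have := coind_fun_linl 0 0 0 hf'; rewrite !scale0r !add0r => h.
    have := coind_fun_linl 1 0 0 hf'; rewrite !scale1r addr0 => h2.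
    by apply: (addrI (coind_fun 0 f)); rewrite -h2 addr0.
  exact: (hW _).1.
subst n; rewrite (gcomp_id hjk).
apply: (@isum_ind _ _ _ _ [set f | isum (fun i => coind_hom (i, m + d))
    (coind_fun (lmul (lmul (lid A j) b) (lid A k)) f)] _ _ _ hf).
  apply: (@linear_preimage _ (E -> Q) (E -> Q)) => //.
by move=> i g hg; apply: (isum1 (j := j)); exact: eA_ract_peirce_hom hg hb.
Qed.

Lemma coind_fun_mem a f : coind_subspace f -> coind_subspace (coind_fun a f).
Proof.
move=> hf; move: a.
apply: (@gspace_ind _ A [set a | coind_subspace (coind_fun a f)]) => [|m a ha].
  apply: (@linear_preimage _ A (E -> Q) (fun a => coind_fun a f)); last exact: subspaceP.
  by move=> c u v; rewrite coind_fun_linl.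
apply: (@isum_ind _ _ _ _ [set f | coind_subspace (coind_fun a f)] _ _ _ hf).
  by apply: (@linear_preimage _ (E -> Q) (E -> Q)) => //; exact: subspaceP.
move=> [i d] g hg.
have : isum (fun i => coind_hom (i, m + d)) (coind_fun a g).
  by apply: coind_fun_deg => //; exact: (isum1 (j := i)).
apply: isum_ind; first exact: subspaceP.
by move=> k h hh; exact: (isum1 (j := (k, m + d))).
Qed.

Definition coind_act (a : A) (u : coind_gspace) : coind_gspace :=
  subsp_of (coind_fun_mem a (subspP u)).

Lemma coind_act_linl u : linear (fun a => coind_act a u).
Proof.
move=> c a b; apply: subsp_inj; rewrite [RHS]subsp_val_linear.
exact: (coind_fun_linl c a b (subspP u)).
Qed.

Lemma coind_act_linr a : linear (coind_act a).
Proof.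
move=> c u v; apply: subsp_inj; rewrite [RHS]subsp_val_linear.
rewrite -[LHS]/(coind_fun a (subsp_val (c *: u + v))) subsp_val_linear.
exact: coind_fun_linr.
Qed.

Lemma coind_actA a b u : coind_act (lmul a b) u = coind_act a (coind_act b u).
Proof.
apply: subsp_inj; apply: funext => x; rewrite /= /coind_fun; congr (subsp_val u _).
by apply: subsp_inj; rewrite /= lmulA.
Qed.

Lemma coind_act_deg d f a u : gdeg d a -> gdeg f u -> gdeg (d + f) (coind_act a u).
Proof. exact: coind_fun_deg. Qed.

Lemma coind_act_sum : direct_sum (fun i : I =>
  [set v | exists w, v = coind_act (lid A i) w]).
Proof.
split; last first.
  exact: act_independent coind_act_linl coind_act_linr coind_actA
    (lid_idem A) (@lid_orth _ _ A).
have hW : is_subspace (isum (fun i : I =>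
    [set v | exists w, v = coind_act (lid A i) w])).
  apply: isum_subspace => i; split; first by exists 0; rewrite (linear0f (coind_act_linr _)).
  by move=> c _ _ [x ->] [w ->]; exists (c *: x + w); rewrite coind_act_linr.
apply: (coind_lift hW) => -[i d] f h [lf _ _ f0]; apply: (isum1 (j := i)).
exists (subsp_of h); apply: subsp_inj; apply: funext => x; rewrite /= /coind_fun.
have [b _ hb] := subspP x.
have hA a : eA e (lmul (hidem_val e) a) by exists a.
have -> : x = subsp_of (hA b) by exact: subsp_inj.
pose g a : E := subsp_of (hA a).
have lg : linear g.
  move=> c u v; apply: subsp_inj; rewrite [RHS]subsp_val_linear.
  exact: lmul_linr.
apply: (@peirce_ind _ _ A [set a | f (g a) = f (eA_ract (g a) (lid A i))]).
  apply: (@eq_subspace _ A Q (fun a => f (g a))) => c u v; first by rewrite lg lf.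
  by rewrite lg eA_ract_linl lf.
move=> j k m c _ /=.
have -> : g (lmul (lmul (lid A j) c) (lid A k)) =
    eA_ract (g (lmul (lid A j) c)) (lid A k).
  by apply: subsp_inj; rewrite /= lmulA.
have [->|/eqP ik] := eqVneq k i.
  by congr f; apply: subsp_inj; rewrite /= -!lmulA lid_idem.
rewrite f0 //; set y := eA_ract _ _; suff -> : y = 0 by rewrite (linear0f lf).
apply: subsp_inj; rewrite [RHS](linear0f (@subsp_val_linear _ _ _)) /=.
by rewrite -!lmulA lid_orth // !lmul0r.
Qed.

(* The A-module which is the direct sum over i of Hom_{eAe}(eA1_i, Q) *)
Definition jstar : gmod A :=
  @GMod _ _ A coind_gspace coind_act coind_act_linl coind_act_linr coind_actA
    coind_act_deg coind_act_sum.

End Coinduction.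

Section TriangularBasis.
Context (K : fieldType) (I : choiceType) (A : lualg K I).
Context (disp : Order.disp_t) (Lam : porderType disp).

(* [tS] is also used as the type of its elements; [val s : I] for [s : tS]. *)
Record triangular_basis := TriangularBasis {
  tS : set I;
  tdot : tS -> Lam;
  tX : I -> tS -> set A;
  tH : tS -> tS -> set A;
  tY : tS -> I -> set A;
  tlower_finite : forall lam : Lam, finite_set [set mu : Lam | (mu <= lam)%O];
  tfiber_finite : forall lam : Lam, finite_set [set s : tS | tdot s = lam];
  tX_sub : forall i s x, tX i s x -> peirce A i (val s) x /\ homogeneous x;
  tH_sub : forall s t h, tH s t h -> peirce A (val s) (val t) h /\ homogeneous h;
  tY_sub : forall t j y, tY t j y -> peirce A (val t) j y /\ homogeneous y;
  tbasis : is_basis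
    [set p : A * A * A | exists s t : tS,
       [/\ exists i, tX i s p.1.1, tH s t p.1.2 & exists j, tY t j p.2]]
    (fun p => lmul (lmul p.1.1 p.1.2) p.2);
  tX_diag : forall s, tX (val s) s = [set lid A (val s)];
  tY_diag : forall s, tY s (val s) = [set lid A (val s)];
  tX_tri : forall s t, s <> t -> tX (val s) t !=set0 -> (tdot t < tdot s)%O;
  tH_tri : forall s t, s <> t -> tH s t !=set0 -> tdot s = tdot t;
  tY_tri : forall s t, s <> t -> tY s (val t) !=set0 -> (tdot s < tdot t)%O;
  tX_finite : forall i, ~ tS i -> finite_set [set s : tS | tX i s !=set0];
  tY_finite : forall i, ~ tS i -> finite_set [set s : tS | tY s i !=set0]
}.

Context (T : triangular_basis).

Definition e_ (lam : Lam) : A :=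
  \sum_(s \in [set s : tS T | tdot s = lam]) lid A (val s).

Lemma e_sum lam : exists r : seq (tS T), uniq r /\ e_ lam = \sum_(s <- r) lid A (val s).
Proof.
exists (finmap.enum_fset (fset_set [set s : tS T | tdot s = lam])).
by split; [exact: finmap.fset_uniq|rewrite /e_ fsbig_finite //; exact: tfiber_finite].
Qed.

Lemma e_homog lam : homogeneous (e_ lam).
Proof.
have [r [_ ->]] := e_sum lam; exists 0; apply: is_subspace_sum; first exact: gdegS.
by move=> s _; exact: lid_deg0.
Qed.

Lemma e_idem lam : lmul (e_ lam) (e_ lam) = e_ lam.
Proof.
have [r [ur ->]] := e_sum lam.
rewrite (linear_sumf _ _ (lmul_linr _)); apply: eq_big_seq => s sr.
rewrite (linear_sumf _ _ (lmul_linl _)) (bigD1_seq s) //= lid_idem.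
rewrite big1 ?addr0 // => t /eqP ts; apply: lid_orth => h.
by apply: ts; exact: val_inj.
Qed.

Definition not_ge_idempotents (lam : Lam) : set A :=
  [set a | exists mu : Lam, ~ (lam <= mu)%O /\ a = e_ mu].

Lemma not_ge_homog lam a : not_ge_idempotents lam a -> homogeneous a.
Proof. by case=> mu [_ ->]; exact: e_homog. Qed.

Definition ideal_not_ge (lam : Lam) : gideal A := ideal_gen (@not_ge_homog lam).

(* The quotient A_{>= lam} of A by the ideal generated by the e_mu, mu not >= lam *)
Definition A_ge (lam : Lam) : lualg K I := quo_alg (ideal_not_ge lam).

Lemma ebar_homog lam : @homogeneous _ (A_ge lam) (quo_pi (ideal_not_ge lam) (e_ lam)).
Proof. by have [d hd] := e_homog lam; exists d, (e_ lam). Qed.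

Lemma ebar_idem lam : @lmul _ _ (A_ge lam) (quo_pi (ideal_not_ge lam) (e_ lam))
  (quo_pi (ideal_not_ge lam) (e_ lam)) = quo_pi (ideal_not_ge lam) (e_ lam).
Proof. by rewrite /= quo_mulE e_idem. Qed.

Definition ebar (lam : Lam) : hidem (A_ge lam) :=
  HIdem (ebar_homog lam) (ebar_idem lam).

(* The algebra A_lam = ebar A_{>= lam} ebar *)
Definition A_at (lam : Lam) : lualg K unit := corner (ebar lam).

(* Delta(b) is the case where P is the projective cover of L_lam(b), and nabla(b)
   below the case where Q is its injective hull. *)
Definition standard (lam : Lam) (P : gmod (A_at lam)) : gmod A :=
  inflate (jshriek P).

Definition costandard (lam : Lam) (Q : gmod (A_at lam)) : gmod A :=
  inflate (jstar Q).

End TriangularBasis.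

(* Main.v *)
Require Import Defs.
From mathcomp Require Import all_boot all_order all_algebra.
From mathcomp Require Import boolp classical_sets.
From mathcomp Require Import functions cardinality fsbigop.

(** Let [e] be the idempotent [e_lam], and [kappa : A -> A_lam] the map sending
    [a] to the class of [e a e]. The module [e V] over [A_lam] is studied through
    maps out of [V]: a homomorphism from [e V] to an [A_lam]-module [M], preceded
    by [v |-> e v], is a linear map [phi : V -> M] with
    [phi (a e v) = kappa a (phi v)], a [corner_hom]. Its [core] is the set of
    [v] with [phi (a v) = 0] for all [a], the largest submodule killed by [phi].

    Heads. Composing [Delta(b) = A e (x) P -> P], [x (x) p |-> kappa x p], with
    [P -> L_lam(b)] gives such a [phi]. A submodule on which [phi] is onto
    covers [P], because [P -> L_lam(b)] is superfluous, hence contains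
    [e (x) P], which generates [Delta(b)]; a submodule on which [phi] vanishes
    lies in the core. As [L_lam(b)] is irreducible there is no third case, so the
    core is the greatest proper submodule of [Delta(b)] ([core_maximal],
    [standard_head]), and [L(b)] is the quotient by it.

    Socles. Evaluation at [e] is a corner homomorphism [nabla(b) -> I] with zero
    core, and it is the universal one: for a module [V] over
    [A_ge lam], every corner homomorphism [V -> I] lifts
    to [V -> nabla(b)], [v |-> (x |-> phi (x v))]. Every nonzero submodule of
    [nabla(b)] has a nonzero image in the injective hull [I], which then contains
    [L_lam(b)]; since evaluation is injective on [e nabla(b)], any two
    nonzero submodules of [nabla(b)] meet ([essential_core_uniform]). So all
    irreducible modules which embed in [nabla(b)] have the same image.

    Labels. Say that [V] has label [b] when [V] is a module over [A_ge lam] with a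
    nonzero corner homomorphism to [L_lam(b)]. An irreducible module with
    label [b] embeds in [nabla(b)], so two of them are isomorphic up to shift, and
    [L(b)] is one of them ([label_iso], [costandard_socle]). The label is unique:
    [lam] is the least weight of [V], and [L_lam(b)] is recovered as [e V]
    ([label_weight_unique], [label_unique]). It exists: for [lam] minimal among
    the weights of an irreducible [V], the factorization [x h y] of the basis
    elements shows that a weight [mu] reached from [e_lam V] satisfies
    [lam <= mu] ([irreducible_lowest_weight]), and [e_lam V] is irreducible over
    [A_lam] ([corner_irreducible]). *)

Set Implicit Arguments.
Unset Strict Implicit.
Unset Printing Implicit Defensive.
Import Order.TTheory GRing.Theory.
Local Open Scope classical_set_scope.
Local Open Scope ring_scope.

(** * Homogeneous submodules and homomorphisms *)

Section GradedSpaces.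
Context (K : fieldType).
Implicit Types V W : gspace K.

(** Homogeneous linear maps commute, up to the shift by [n], with taking homogeneous components; this
    is what makes kernels, images and inverses of such maps graded. *)
Lemma gcomp_morph V W n (f : V -> W) : linear f ->
  (forall d v, gdeg d v -> gdeg (d + n) (f v)) ->
  forall d v, f (gcomp d v) = gcomp (d + n) (f v).
Proof.
move=> lf df d; apply: (@gspace_ind _ V [set v | f (gcomp d v) = gcomp (d + n) (f v)]).
  apply: (@eq_subspace _ V W (fun v => f (gcomp d v))) => c u v.
    by rewrite gcomp_linear lf.
  by rewrite lf gcomp_linear.
move=> e v hv /=; have [->|de] := eqVneq d e.
  by rewrite !gcomp_id //; exact: df.
rewrite (gcomp_ne de hv) (linear0f lf) (@gcomp_ne _ _ _ (e + n)) //; last exact: df.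
by rewrite (inj_eq (addIr n)).
Qed.

End GradedSpaces.

Section GradedModules.
Context (K : fieldType) (I : choiceType) (A : lualg K I).
Implicit Types V W : gmod A.

Section Submodule.
Context V (N : set V) (hN : is_subspace N)
  (cN : forall d v, N v -> N (gcomp d v)) (aN : forall a v, N v -> N (act a v)).

Lemma submodule_graded v : Subspace hN v ->
  isum (fun d => [set w | gdeg d w /\ Subspace hN w]) v.
Proof.
move=> Nv; exists (csupp (gdeg_sum V) v), (fun d => gcomp d v); split.
- exact: csupp_uniq.
- by move=> d _; split; [exact: gcompP|exact: cN].
- exact: icomp_sum.
Qed.

Definition submodule : gsubmod V :=
  @GSubmod _ _ _ V (GSubspace submodule_graded) aN.

End Submodule.

Lemma irreducible_submodule V (N : set V) : irreducible V -> is_subspace N ->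
  (forall d v, N v -> N (gcomp d v)) -> (forall a v, N v -> N (act a v)) ->
  (exists2 v, N v & v <> 0) -> forall v, N v.
Proof.
move=> [_ irr] hN cN aN [v Nv v0].
by case: (irr (submodule hN cN aN)) => // /(_ v Nv).
Qed.

Lemma gsubmod_comp V (N : gsubmod V) d v : N v -> N (gcomp d v).
Proof. exact: gsub_comp. Qed.

Lemma act_gcomp V n (a : A) d (v : V) : gdeg n a ->
  act a (gcomp d v) = gcomp (d + n) (act a v).
Proof.
move=> ha; apply: gcomp_morph; first exact: act_linr.
by move=> e w hw; rewrite addrC; exact: act_deg.
Qed.

Lemma actB V (a : A) (u v : V) : act a (u - v) = act a u - act a v.
Proof. by rewrite addrC -scaleN1r act_linr scaleN1r addrC. Qed.

Lemma linearBf (U U' : lmodType K) (f : U -> U') u v : linear f -> f (u - v) = f u - f v.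
Proof. by move=> lf; rewrite addrC -scaleN1r lf scaleN1r addrC. Qed.

Lemma linear_kernel0 (U U' : lmodType K) (f : U -> U') : linear f ->
  (forall u, f u = 0 -> u = 0) -> injective f.
Proof.
move=> lf k0 u v uv; apply/eqP; rewrite -subr_eq0; apply/eqP/k0.
by rewrite linearBf // uv subrr.
Qed.

Section Homomorphism.
Context V W n (f : V -> W) (hf : is_hom n f).

Lemma hom_linear : linear f. Proof. by case: hf. Qed.
Lemma hom_act a v : f (act a v) = act a (f v). Proof. by case: hf. Qed.
Lemma hom_deg d v : gdeg d v -> gdeg (d + n) (f v). Proof. by case: hf => _ _; apply. Qed.
Lemma hom0 : f 0 = 0. Proof. exact: linear0f hom_linear. Qed.

Lemma hom_gcomp d v : f (gcomp d v) = gcomp (d + n) (f v).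
Proof. exact: gcomp_morph hom_linear hom_deg d v. Qed.

Section Preimage.
Context (N : gsubmod W).

Lemma hom_preimage_subspace : is_subspace (f @^-1` N).
Proof. by apply: linear_preimage; [exact: hom_linear|exact: subspaceP]. Qed.

Lemma hom_preimage_gcomp d v : N (f v) -> N (f (gcomp d v)).
Proof. by rewrite hom_gcomp; exact: gsubmod_comp. Qed.

Lemma hom_preimage_act a v : N (f v) -> N (f (act a v)).
Proof. by rewrite hom_act; exact: gsubmodP. Qed.

Definition hom_preimage : gsubmod V :=
  submodule hom_preimage_subspace hom_preimage_gcomp hom_preimage_act.
End Preimage.

Section Image.
Context (N : gsubmod V).

Lemma hom_image_subspace : is_subspace (f @` N).
Proof. by apply: linear_image; [exact: hom_linear|exact: subspaceP]. Qed.

Lemma hom_image_gcomp d w : (f @` N) w -> (f @` N) (gcomp d w).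
Proof.
move=> [v Nv <-]; exists (gcomp (d - n) v); first exact: gsubmod_comp.
by rewrite hom_gcomp subrK.
Qed.

Lemma hom_image_act a w : (f @` N) w -> (f @` N) (act a w).
Proof.
by move=> [v Nv <-]; exists (act a v); [exact: gsubmodP|exact: hom_act].
Qed.

Definition hom_image : gsubmod W :=
  submodule hom_image_subspace hom_image_gcomp hom_image_act.
End Image.

(** The inverse of a graded bijection is graded: [g v] and its component in degree
    [d - n] have the same image. *)
Lemma hom_inv g : cancel f g -> cancel g f -> is_hom (- n) g.
Proof.
move=> fK gK; have fI := can_inj fK; split=> [c u v|a v|d v hv].
- by apply: fI; rewrite hom_linear !gK.
- by apply: fI; rewrite hom_act !gK.
- have -> : g v = gcomp (d - n) (g v); last exact: gcompP.
  by apply: fI; rewrite hom_gcomp gK subrK (gcomp_id hv).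
Qed.

Lemma irreducible_hom_inj : irreducible V -> (exists v, f v <> 0) -> injective f.
Proof.
move=> irr [v fv]; apply: (linear_kernel0 hom_linear) => u fu.
apply: contrapT => u0; apply: fv.
apply: (irreducible_submodule (N := [set v | f v = 0]) irr) => [||a w|].
- by split=> [|c x y] /=; [exact: hom0|move=> hx hy; rewrite hom_linear hx hy scaler0 addr0].
- by move=> d w /= fw; rewrite hom_gcomp fw (linear0f (gcomp_linear _)).
- by move=> /= fw; rewrite hom_act fw act0r.
- by exists u.
Qed.

End Homomorphism.

Lemma whole_module_subspace V : is_subspace [set: V]. Proof. by []. Qed.

Definition whole_module V : gsubmod V :=
  submodule (whole_module_subspace V) (fun _ _ _ => Logic.I) (fun _ _ _ => Logic.I).

Lemma hom_shift V W n d (f : V -> W) :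
  @is_hom _ _ A V (shift W n) d f <-> is_hom (d + n) f.
Proof. by split=> -[lf af df]; split=> // k v hv; have := df k v hv; rewrite /= addrA. Qed.

Lemma hom_bijective V W n (f : V -> W) : is_hom n f -> injective f ->
  (forall w, exists v, f v = w) -> exists g, [/\ is_hom (- n) g, cancel f g & cancel g f].
Proof.
move=> hf fI fS; pose g w := projT1 (cid (fS w)).
have gK : cancel g f by move=> w; exact: projT2 (cid (fS w)).
have fK : cancel f g by move=> v; apply: fI; rewrite gK.
by exists g; split=> //; exact: hom_inv hf g fK gK.
Qed.

Lemma iso_shift V W n (f : V -> W) : is_hom n f -> injective f ->
  (forall w, exists v, f v = w) -> iso V (shift W n).
Proof.
move=> hf fI fS; have [g [_ fK gK]] := hom_bijective hf fI fS.
exists f; split; last by exists g.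
by apply/hom_shift; rewrite add0r.
Qed.

Lemma irreducible_bijective V W n (f : V -> W) : is_hom n f -> injective f ->
  (forall w, exists v, f v = w) -> irreducible V -> irreducible W.
Proof.
move=> hf fI fS [[v v0] irr]; split.
  by exists (f v) => fv; apply/v0/fI; rewrite fv (hom0 hf).
move=> N; have [h|h] := irr (hom_preimage hf N); [left=> w Nw|right=> w].
  by move: Nw; have [u <-] := fS w => Nu; rewrite (h u Nu) (hom0 hf).
by have [u <-] := fS w; exact: h.
Qed.

(** Both modules are identified with their common image in [W]. *)
Lemma homs_same_image V V' W n n' (f : V -> W) (f' : V' -> W) :
  is_hom n f -> is_hom n' f' -> injective f -> injective f' ->
  (forall w, (exists v, f v = w) <-> exists v, f' v = w) ->
  iso V (shift V' (n - n')).
Proof.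
move=> hf hf' fI fI' im.
have ex v : exists v', f' v' = f v by apply/im; exists v.
pose g v := projT1 (cid (ex v)); have gE v : f' (g v) = f v by exact: projT2 (cid (ex v)).
have hg : is_hom (n - n') g.
  split=> [c u v|a v|d v hv].
  - by apply: fI'; rewrite (hom_linear hf') !gE (hom_linear hf).
  - by apply: fI'; rewrite (hom_act hf') !gE (hom_act hf).
  - have -> : g v = gcomp (d + (n - n')) (g v); last exact: gcompP.
    apply: fI'; rewrite (hom_gcomp hf') -addrA subrK gE.
    by rewrite (gcomp_id (hom_deg hf hv)).
apply: (iso_shift hg) => [u v /(congr1 f')|v']; first by rewrite !gE => /fI.
have [v fv] : exists v, f v = f' v' by apply/im; exists v'.
by exists v; apply: fI'; rewrite gE.
Qed.

End GradedModules.

(** * Greatest proper submodules *)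

Section Quotients.
Context (K : fieldType) (I : choiceType) (A : lualg K I) (V : gmod A).

Lemma quo_pi_hom (N : gsubmod V) : @is_hom _ _ A V (quo_gmod N) 0 (quo_pi N).
Proof.
split=> [|a v|d v hv]; first exact: quo_pi_linear.
  by rewrite -[RHS]/(quo_act _ _) quo_actE.
by rewrite addr0; exists v.
Qed.

(** Another submodule [N] with irreducible quotient lies in [M], and if [M] were not
    contained in [N] its image would be all of [V / N], so that [V = M + N = M]. *)
Lemma greatest_submodule_quotient (M : gsubmod V) : (exists v, ~ M v) ->
  (forall N : gsubmod V, (forall v, N v -> M v) \/ (forall v, N v)) ->
  irreducible (quo_gmod M) /\
  forall N : gsubmod V, irreducible (quo_gmod N) -> forall v, N v <-> M v.
Proof.
move=> [v0 Mv0] dich; split; first split.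
- by exists (quo_pi M v0) => /quo_pi0.
- move=> N; have [h|h] := dich (hom_preimage (quo_pi_hom M) N).
    left=> u; rewrite -(quo_reprK u) => Nu; apply/quo_pi0; exact: h.
  by right=> u; rewrite -(quo_reprK u); exact: h.
move=> N [[u u0] irr]; have [NM|NT] := dich N; last first.
  by case: u0; rewrite -(quo_reprK u); apply/quo_pi0; exact: NT.
move=> v; split; first exact: NM.
have [h|h] := irr (hom_image (quo_pi_hom N) M).
  by move=> Mv; apply/quo_pi0/h; exists v.
have [w Mw /quo_piP Nwv] := h (quo_pi N v0); case: Mv0.
(* [w] in [M] and [v0] agree modulo [N], which is contained in [M]. *)
have -> : v0 = w - (w - v0) by rewrite subKr.
by apply: is_subspaceB => //; [exact: subspaceP|exact: NM].
Qed.

End Quotients.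

(** * Corner maps and corner homomorphisms *)

Section UnitalAlgebra.
Context (K : fieldType) (C : lualg K unit).

Lemma act1l (M : gmod C) (m : M) : act (lid C tt) m = m.
Proof.
have [r mE] := gmod_dec m; rewrite {1}mE (linear_sumf _ _ (act_linr _)).
by rewrite [RHS]mE; apply: eq_bigr => -[] _; rewrite -actA lid_idem.
Qed.

End UnitalAlgebra.

(** A [corner_map] presents [C] as a quotient of the unital algebra [e A e] by
    means of [a |-> e a e]; [cm_lift] is the graded form of surjectivity.
    Both [A -> e A e] and its composites with quotient maps [A' -> A] are instances,
    so that [A] and [A_ge lam] are treated on the same footing. *)
Record corner_map (K : fieldType) (I : choiceType) (A : lualg K I)
    (C : lualg K unit) := CornerMap {
  cm_idem : hidem A;
  cm_fun :> A -> C;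
  cm_linear : linear cm_fun;
  cm_deg : forall d a, gdeg d a -> gdeg d (cm_fun a);
  cm_lift : forall d c, gdeg d c -> exists2 a, gdeg d a & cm_fun a = c;
  cm_mul : forall a b,
    cm_fun (lmul (lmul a (hidem_val cm_idem)) b) = lmul (cm_fun a) (cm_fun b);
  cm_one : cm_fun (hidem_val cm_idem) = lid C tt
}.

Section CornerHomomorphisms.
Context (K : fieldType) (I : choiceType) (A : lualg K I) (C : lualg K unit).
Context (kappa : corner_map A C).
Local Notation e := (hidem_val (cm_idem kappa)).

Lemma cm_surj c : exists a, kappa a = c.
Proof.
move: c; apply: (@gspace_ind _ C [set c | exists a, kappa a = c]) => [|d c /(@cm_lift _ _ _ _ kappa)].
  split; first by exists 0; exact: linear0f (cm_linear kappa).
  by move=> k _ _ [a <-] [b <-]; exists (k *: a + b); exact: cm_linear.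
by case=> a _; exists a.
Qed.

(** These maps correspond to the homomorphisms [e V -> M] of degree [n], without
    requiring [e V] to be a [C]-module beforehand. *)
Definition corner_hom (V : gmod A) (M : gmod C) (n : int) (phi : V -> M) : Prop :=
  [/\ linear phi, forall d v, gdeg d v -> gdeg (d + n) (phi v) &
      forall a v, phi (act a (act e v)) = act (kappa a) (phi v)].

Lemma corner_hom_comp (V : gmod A) (M M' : gmod C) m n (phi : V -> M) (f : M -> M') :
  corner_hom m phi -> is_hom n f -> corner_hom (m + n) (f \o phi).
Proof.
move=> [lphi dphi aphi] hf; split=> [c u v|d v hv|a v] /=.
- by rewrite lphi (hom_linear hf).
- by rewrite addrA; exact: (hom_deg hf (dphi _ _ hv)).
- by rewrite aphi (hom_act hf).
Qed.

Lemma hom_corner_comp (V V' : gmod A) (M : gmod C) m n (f : V -> V') (phi : V' -> M) :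
  is_hom m f -> corner_hom n phi -> corner_hom (m + n) (phi \o f).
Proof.
move=> hf [lphi dphi aphi]; split=> [c u v|d v hv|a v] /=.
- by rewrite (hom_linear hf) lphi.
- by rewrite addrA; exact: (dphi _ _ (hom_deg hf hv)).
- by rewrite !(hom_act hf) aphi.
Qed.

Section Theory.
Context (V : gmod A) (M : gmod C) (n : int) (phi : V -> M) (hphi : corner_hom n phi).

Lemma ch_linear : linear phi. Proof. by case: hphi. Qed.
Lemma ch_deg d v : gdeg d v -> gdeg (d + n) (phi v). Proof. by case: hphi => _ h _; exact: h. Qed.
Lemma ch_act a v : phi (act a (act e v)) = act (kappa a) (phi v). Proof. by case: hphi. Qed.
Lemma ch_idem v : phi (act e v) = phi v.
Proof. by rewrite -[X in act X v]hidem_idem actA ch_act cm_one act1l. Qed.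
Lemma ch_gcomp d v : phi (gcomp d v) = gcomp (d + n) (phi v).
Proof. exact: gcomp_morph ch_linear ch_deg d v. Qed.

Section Image.
Context (N : gsubmod V).

Lemma ch_image_subspace : is_subspace (phi @` N).
Proof. by apply: linear_image; [exact: ch_linear|exact: subspaceP]. Qed.

Lemma ch_image_gcomp d m : (phi @` N) m -> (phi @` N) (gcomp d m).
Proof.
move=> [v Nv <-]; exists (gcomp (d - n) v); first exact: gsubmod_comp.
by rewrite ch_gcomp subrK.
Qed.

Lemma ch_image_act c m : (phi @` N) m -> (phi @` N) (act c m).
Proof.
have [a <-] := cm_surj c; move=> [v Nv <-].
by exists (act a (act e v)); [do 2 apply: gsubmodP|exact: ch_act].
Qed.

Definition ch_image : gsubmod M :=
  submodule ch_image_subspace ch_image_gcomp ch_image_act.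
End Image.

Definition core_set : set V := [set v | forall a, phi (act a v) = 0].

Lemma core_subspace : is_subspace core_set.
Proof.
split=> [a|c u v hu hv a]; first by rewrite act0r (linear0f ch_linear).
by rewrite act_linr ch_linear hu hv scaler0 addr0.
Qed.

Lemma core_gcomp d v : core_set v -> core_set (gcomp d v).
Proof.
move=> hv a; move: a.
apply: (@gspace_ind _ A [set a | phi (act a (gcomp d v)) = 0]) => [|k a ha /=].
  apply: (@eq_subspace _ A M (fun a => phi (act a (gcomp d v))) (fun=> 0)).
    by move=> c a b; rewrite act_linl ch_linear.
  by move=> c u w; rewrite scaler0 addr0.
by rewrite (act_gcomp _ _ ha) ch_gcomp hv (linear0f (gcomp_linear _)).
Qed.

Lemma core_act b v : core_set v -> core_set (act b v).
Proof. by move=> hv a; rewrite -actA. Qed.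

Definition core : gsubmod V := submodule core_subspace core_gcomp core_act.

Lemma core_ker v : core v -> phi v = 0.
Proof. by move=> /(_ e); rewrite ch_idem. Qed.

(** The image of a submodule is a submodule of the irreducible [M]: if it is zero the
    submodule lies in the core, and if it is [M] the submodule is everything. *)
Lemma core_maximal : irreducible M -> (exists v, phi v <> 0) ->
  (forall N : gsubmod V, (forall m, exists2 v, N v & phi v = m) -> forall v, N v) ->
  irreducible (quo_gmod core) /\
  forall N : gsubmod V, irreducible (quo_gmod N) -> forall v, N v <-> core v.
Proof.
move=> irr [v0 phi0] sup; apply: greatest_submodule_quotient.
  by exists v0 => /core_ker.
move=> N; have [h|h] := irr.2 (ch_image N); last by right; exact: sup h.
by left=> v Nv a; apply: h; exists (act a v) => //; exact: gsubmodP.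
Qed.

Definition core_factor : quo_gmod core -> M := quo_lift (W := core) phi.

Lemma core_factorE v : core_factor (quo_pi core v) = phi v.
Proof. by apply: quo_liftE ch_linear _ _; exact: core_ker. Qed.

Lemma core_factor_hom : corner_hom n core_factor.
Proof.
split=> [|d _ [v hv <-]|a u].
- by apply: quo_lift_linear ch_linear _; exact: core_ker.
- by rewrite core_factorE; exact: ch_deg.
- rewrite -(quo_reprK u) -!(hom_act (quo_pi_hom core)) !core_factorE; exact: ch_act.
Qed.

Lemma irreducible_core : irreducible V -> (exists v, phi v <> 0) ->
  forall v, core_set v -> v = 0.
Proof.
move=> irr [v0 phi0]; have [//|h] := irr.2 core.
by case: phi0; exact/core_ker/h.
Qed.

(** The difference [e u - e v] lies in the core, as [phi (a e w) = kappa a (phi w)]. *)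
Lemma core0_idem_inj : (forall v, core_set v -> v = 0) ->
  forall u v, phi u = phi v -> act e u = act e v.
Proof.
move=> c0 u v uv; apply/eqP; rewrite -subr_eq0 -actB; apply/eqP/c0 => a.
by rewrite ch_act (linearBf _ _ ch_linear) uv subrr act0r.
Qed.

Lemma ch_surj : irreducible M -> (exists v, phi v <> 0) -> forall m, exists v, phi v = m.
Proof.
move=> irr [v0 phi0] m; have [h|h] := irr.2 (ch_image (whole_module V)).
  by case: phi0; apply: h; exists v0.
by have [v _ <-] := h m; exists v.
Qed.

End Theory.

(** Both [M] and [M'] are isomorphic to the corner [e V]: by [core0_idem_inj] each map factors
    through an injection of [e V], so that [phi v] determines [phi' v] and
    conversely. *)
Lemma corner_homs_iso (V : gmod A) (M M' : gmod C) n n' (phi : V -> M) (phi' : V -> M') :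
  irreducible V -> irreducible M -> irreducible M' ->
  corner_hom n phi -> corner_hom n' phi' ->
  (exists v, phi v <> 0) -> (exists v, phi' v <> 0) -> iso M (shift M' (n' - n)).
Proof.
move=> irrV irrM irrM' hphi hphi' phi0 phi0'.
have sec m := cid (ch_surj hphi irrM phi0 m).
pose s m := projT1 (sec m); have sE m : phi (s m) = m by exact: projT2 (sec m).
have inj u v : phi u = phi v -> phi' u = phi' v.
  move=> /(core0_idem_inj hphi (irreducible_core hphi irrV phi0)) uv.
  by rewrite -(ch_idem hphi') uv (ch_idem hphi').
have inj' u v : phi' u = phi' v -> phi u = phi v.
  move=> /(core0_idem_inj hphi' (irreducible_core hphi' irrV phi0')) uv.
  by rewrite -(ch_idem hphi) uv (ch_idem hphi).
apply: (@iso_shift _ _ _ _ _ _ (phi' \o s)).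
- split=> [c x y|c m|d m hm] /=.
  + by rewrite -(ch_linear hphi'); apply: inj; rewrite (ch_linear hphi) !sE.
  + have [a <-] := cm_surj c; rewrite -(ch_act hphi').
    by apply: inj; rewrite (ch_act hphi) !sE.
  + rewrite (_ : phi' (s m) = phi' (gcomp (d - n) (s m))).
      have -> : d + (n' - n) = d - n + n' by rewrite addrAC addrA.
      exact: (ch_deg hphi' (gcompP _ _)).
    by apply: inj; rewrite (ch_gcomp hphi) subrK sE (gcomp_id hm).
- by move=> x y /= /inj'; rewrite !sE.
- move=> m'; have [v <-] := ch_surj hphi' irrM' phi0' m'.
  by exists (phi v); apply: inj; rewrite sE.
Qed.

(** The image of a nonzero submodule of [W] in [Q] is nonzero, hence contains [i L].
    Two such submodules therefore contain [v] and [v'] with the same nonzero value,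
    and then [e v = e v'] lies in both. *)
Lemma essential_core_uniform (W : gmod A) (L Q : gmod C) n (psi : W -> Q) (i : L -> Q) :
  corner_hom n psi -> (forall w, (forall a, psi (act a w) = 0) -> w = 0) ->
  irreducible L -> is_hom 0 i -> injective i ->
  (forall N : gsubmod Q, (exists2 v, N v & v <> 0) -> exists2 x, N (i x) & x <> 0) ->
  forall N N' : gsubmod W, (exists2 v, N v & v <> 0) -> (exists2 v, N' v & v <> 0) ->
  exists v, [/\ N v, N' v & v <> 0].
Proof.
move=> hpsi c0 irr hi iI ess N N' hN hN'.
have covers (U : gsubmod W) : (exists2 v, U v & v <> 0) ->
    forall l, exists2 v, U v & psi v = i l.
  move=> [v Uv v0].
  have [a pa] : exists a, psi (act a v) <> 0.
    by apply: contrapT => h; apply/v0/c0 => a; apply: contrapT => pa; apply: h; exists a.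
  have [|x Ux x0] := ess (ch_image hpsi U).
    by exists (psi (act a v)) => //; exists (act a v) => //; exact: gsubmodP.
  have [h|h] := irr.2 (hom_preimage hi (ch_image hpsi U)); last exact: h.
  by case: x0; exact: h.
have [[l l0] _] := irr.
have [v Nv vl] := covers N hN l; have [v' Nv' vl'] := covers N' hN' l.
have ee : act e v = act e v' by apply: (core0_idem_inj hpsi c0); rewrite vl vl'.
exists (act e v); split; first exact: gsubmodP.
  by rewrite ee; exact: gsubmodP.
move=> ev0; apply/l0/iI.
by rewrite -vl -(ch_idem hpsi) ev0 (linear0f (ch_linear hpsi)) (hom0 hi).
Qed.

(** * The corner of an irreducible module *)

Section CornerModule.
Context (V : gmod A).
Context (hV : forall a, kappa a = 0 -> forall v : V, act e (act a (act e v)) = 0).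

Lemma act_idem_deg d (v : V) : gdeg d v -> gdeg d (act e v).
Proof. by move=> hv; rewrite -[d]add0r; exact: act_deg (hidem_deg0 _) hv. Qed.

Definition eV : gsubspace V := gimage (act_linr e) act_idem_deg.

Lemma eVP (u : gsub eV) : act e (subsp_val u) = subsp_val u.
Proof. by have [v _ <-] := subspP u; rewrite -actA hidem_idem. Qed.

Lemma eV_act a (v : V) : eV (act e (act a v)).
Proof. by exists (act a v). Qed.

Definition corner_act (c : C) (u : gsub eV) : gsub eV :=
  subsp_of (eV_act (projT1 (cid (cm_surj c))) (subsp_val u)).

Lemma corner_actE a u : subsp_val (corner_act (kappa a) u) = act e (act a (subsp_val u)).
Proof.
rewrite /corner_act /=; case: cid => b /= ba; apply/eqP; rewrite -subr_eq0; apply/eqP.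
have := hV (a := b - a) _ (subsp_val u); rewrite eVP => <-.
  by rewrite -actB (linearBf _ _ (act_linl _)).
by rewrite (linearBf _ _ (cm_linear kappa)) ba subrr.
Qed.

Lemma corner_act_linl u : linear (fun c => corner_act c u).
Proof.
move=> k c c'; have [a <-] := cm_surj c; have [a' <-] := cm_surj c'.
apply: subsp_inj; rewrite [RHS]subsp_val_linear -cm_linear !corner_actE.
by rewrite act_linl act_linr.
Qed.

Lemma corner_act_linr c : linear (corner_act c).
Proof.
move=> k u v; have [a <-] := cm_surj c.
apply: subsp_inj; rewrite [RHS]subsp_val_linear !corner_actE.
by rewrite subsp_val_linear !act_linr.
Qed.

Lemma corner_actA c c' u : corner_act (lmul c c') u = corner_act c (corner_act c' u).
Proof.
have [a <-] := cm_surj c; have [a' <-] := cm_surj c'.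
by apply: subsp_inj; rewrite -cm_mul !corner_actE !actA.
Qed.

Lemma corner_act_deg d k c u : gdeg d c -> gdeg k u -> gdeg (d + k) (corner_act c u).
Proof.
move=> /(@cm_lift _ _ _ _ kappa)[a ha <-] hu.
rewrite -[gdeg _ _]/(gdeg (d + k) (subsp_val _)) corner_actE; apply: act_idem_deg.
exact: act_deg.
Qed.

Lemma corner_act1 u : corner_act (lid C tt) u = u.
Proof. by apply: subsp_inj; rewrite -(cm_one kappa) corner_actE !eVP. Qed.

Lemma corner_act_sum :
  direct_sum (fun j : unit => [set v | exists w, v = corner_act (lid C j) w]).
Proof.
split; last exact: act_independent corner_act_linl corner_act_linr corner_actA
  (lid_idem C) (@lid_orth _ _ C).
by move=> u; apply: (isum1 (j := tt)); exists u; rewrite corner_act1.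
Qed.

Definition corner_gmod : gmod C :=
  @GMod _ _ C (gsub eV) corner_act corner_act_linl corner_act_linr corner_actA
    corner_act_deg corner_act_sum.

Definition to_corner (v : V) : corner_gmod :=
  subsp_of (ex_intro2 _ _ v Logic.I erefl : eV (act e v)).

Lemma to_corner_hom : corner_hom 0 to_corner.
Proof.
split=> [c u v|d v hv|a v].
- by apply: subsp_inj; rewrite [RHS]subsp_val_linear /= act_linr.
- by rewrite addr0; exact: act_idem_deg.
- by apply: subsp_inj; rewrite [RHS]corner_actE.
Qed.

(** Given a submodule [N] of [e V], the vectors [v] with [e a v] in [N] for all [a] form
    a submodule of [V]. It contains [N], since [e a u = kappa a u] for [u] in [e V]. *)
Lemma corner_irreducible : irreducible V -> (exists v : V, act e v <> 0) ->
  irreducible corner_gmod.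
Proof.
move=> irr [v0 ev0]; split.
  exists (to_corner v0) => /(congr1 (@subsp_val _ _ _)) /= h; apply: ev0.
  rewrite h; exact: linear0f (@subsp_val_linear _ _ eV).
move=> N; have [h|] := pselect (forall u, N u -> u = 0); first by left.
move=> h; right.
have [u0 [Nu0 u00]] : exists u0, N u0 /\ u0 <> 0.
  apply: contrapT => h2; apply: h => u Nu; apply: contrapT => u0; apply: h2; by exists u.
pose S : set V := [set v | forall a, N (to_corner (act a v))].
suff all v : S v.
  move=> u; have -> : u = to_corner (act e (subsp_val u)); last exact: all.
  by apply: subsp_inj; rewrite /= !eVP.
move: v; apply: (irreducible_submodule irr) => [||b v hv a|].
- split=> [a|c u v hu hv a].
    by rewrite act0r (linear0f (ch_linear to_corner_hom)); exact: (subspaceP N).1.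
  rewrite act_linr (ch_linear to_corner_hom); exact: (subspaceP N).2.
- move=> d v hv a; move: a.
  apply: (@gspace_ind _ A [set a | N (to_corner (act a (gcomp d v)))]) => [|k a ha /=].
    apply: (@linear_preimage _ A corner_gmod (fun a => to_corner (act a (gcomp d v))) N).
      by move=> c a b; rewrite act_linl (ch_linear to_corner_hom).
    exact: subspaceP.
  rewrite (act_gcomp _ _ ha) (ch_gcomp to_corner_hom).
  exact: gsubmod_comp.
- by rewrite -actA.
exists (subsp_val u0); last first.
  move=> h0; apply: u00; apply: subsp_inj; rewrite h0.
  exact/esym/(linear0f (@subsp_val_linear _ _ eV)).
move=> a; have -> : to_corner (act a (subsp_val u0)) = act (kappa a) u0.
  by apply: subsp_inj; rewrite [RHS]corner_actE.
exact: gsubmodP.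
Qed.

End CornerModule.
End CornerHomomorphisms.

(** * Induction and coinduction along a corner *)

Section CornerProjection.
Context (K : fieldType) (I : choiceType) (A : lualg K I) (e : hidem A).
Local Notation ev := (hidem_val e).
Local Notation C := (corner e).

Lemma eAe_proj (a : A) : eAe e (lmul (lmul ev a) ev).
Proof. by exists a. Qed.

Definition corner_proj (a : A) : C := subsp_of (eAe_proj a).

Lemma corner_proj_linear : linear corner_proj.
Proof.
by move=> c a b; apply: subsp_inj; rewrite [RHS]subsp_val_linear; exact: corner_linear.
Qed.

Lemma corner_proj_id (c : C) : corner_proj (subsp_val c) = c.
Proof.
by apply: subsp_inj => /=; have /eAeP[/AeP h /eAP h'] := subspP c; rewrite h' h.
Qed.

Lemma corner_proj_lift d (c : C) : gdeg d c -> exists2 a, gdeg d a & corner_proj a = c.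
Proof. by exists (subsp_val c) => //; exact: corner_proj_id. Qed.

Lemma corner_proj_mul a b :
  corner_proj (lmul (lmul a ev) b) = lmul (corner_proj a) (corner_proj b).
Proof.
apply: subsp_inj; rewrite /= !lmulA; do 2 congr (lmul _ _).
by rewrite -[in RHS]lmulA hidem_idem.
Qed.

Lemma corner_proj_one : corner_proj ev = lid C tt.
Proof. by apply: subsp_inj; rewrite /= !hidem_idem. Qed.

Definition corner_projection : corner_map A C :=
  @CornerMap _ _ A C e corner_proj corner_proj_linear (@corner_deg _ _ A e)
    corner_proj_lift corner_proj_mul corner_proj_one.

Lemma Ae_idem : Ae e ev. Proof. by rewrite AeP hidem_idem. Qed.
Lemma eA_idem : eA e ev. Proof. by rewrite eAP hidem_idem. Qed.

Section Induced.
Context (P : gmod C).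

Definition shriek_pairing (x : gsub (Ae e)) (p : P) : P :=
  act (corner_proj (subsp_val x)) p.

Lemma shriek_pairing_linl p : linear (fun x => shriek_pairing x p).
Proof.
move=> c x y; rewrite /shriek_pairing subsp_val_linear corner_proj_linear.
exact: act_linl.
Qed.

Lemma shriek_pairing_linr x : linear (shriek_pairing x).
Proof. exact: act_linr. Qed.

Lemma shriek_pairing_bal x b p :
  shriek_pairing (Ae_ract x b) p = shriek_pairing x (act b p).
Proof.
rewrite /shriek_pairing -actA; congr act.
have /AeP xe := subspP x.
by rewrite -[in RHS](corner_proj_id b) -[RHS]corner_proj_mul xe.
Qed.

Definition shriek_proj : jshriek P -> P := tensor_lift shriek_pairing.

Lemma shriek_projE x p :
  shriek_proj (tens x p) = act (corner_proj (subsp_val x)) p.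
Proof.
exact: tensor_liftE shriek_pairing_linl shriek_pairing_linr shriek_pairing_bal x p.
Qed.

Lemma shriek_proj_unit p : shriek_proj (tens (subsp_of Ae_idem) p) = p.
Proof. by rewrite shriek_projE corner_proj_one act1l. Qed.

Lemma shriek_proj_linear : linear shriek_proj.
Proof.
exact: tensor_lift_linear shriek_pairing_linl shriek_pairing_linr shriek_pairing_bal.
Qed.

Lemma shriek_proj_hom : corner_hom corner_projection 0 shriek_proj.
Proof.
split=> [|d v|a v]; first exact: shriek_proj_linear.
  rewrite addr0; move: v.
  apply: (@span_ind _ _ _ [set v | gdeg d (shriek_proj v)]).
    exact: linear_preimage shriek_proj_linear (gdegS P d).
  move=> _ [m [n [x [p [<- hx hp ->]]]]] /=; rewrite shriek_projE.
  by apply: act_deg hp; exact: corner_deg.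
move: v; apply: (@tens_ind _ _ _ _ _
  [set v | shriek_proj (act a (act ev v)) = act (corner_proj a) (shriek_proj v)]).
  apply: (@eq_subspace _ (jshriek P) P (fun v => shriek_proj (act a (act ev v)))
    (fun v => act (corner_proj a) (shriek_proj v))).
    by move=> c u v; rewrite !act_linr shriek_proj_linear.
  by move=> c u v; rewrite shriek_proj_linear act_linr.
move=> x p /=; rewrite !tensor_actE !shriek_projE -actA; congr act.
by rewrite -[RHS]corner_proj_mul /= lmulA.
Qed.

(** For [x] in [A e] one has [e x = e x e], which moves across the tensor sign; thus
    [e (A e (x) P)] is a copy of [P], with [shriek_proj] as the identification. *)
Lemma shriek_idem (t : jshriek P) : act ev t = tens (subsp_of Ae_idem) (shriek_proj t).
Proof.
move: t; apply: (@tens_ind _ _ _ _ _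
  [set t | tensor_act ev t = tens (subsp_of Ae_idem) (shriek_proj t)]).
  apply: (@eq_subspace _ (jshriek P) (jshriek P)); first exact: tensor_act_linr.
  by move=> c u v; rewrite shriek_proj_linear tens_linr.
move=> x p /=; rewrite tensor_actE shriek_projE -tens_bal; congr tens.
apply: subsp_inj; have /AeP xe := subspP x.
by rewrite /= !lmulA hidem_idem -[RHS]lmulA xe.
Qed.

(** [x (x) p = x (e (x) p)], and [e (x) p = e v] for any [v] above [p]. *)
Lemma shriek_generated (N : set (jshriek P)) : is_subspace N ->
  (forall a v, N v -> N (act a v)) -> (forall p, exists2 v, N v & shriek_proj v = p) ->
  forall v, N v.
Proof.
move=> hN aN cov; apply: (tens_ind hN) => x p.
have [v Nv <-] := cov p; have /AeP xe := subspP x.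
have -> : tens x (shriek_proj v) = act (subsp_val x) (act ev v); last exact/aN/aN.
rewrite shriek_idem [RHS]tensor_actE; congr tens.
by apply: subsp_inj; rewrite /= xe.
Qed.

End Induced.

Section Coinduced.
Context (Q : gmod C).

Definition star_eval (u : jstar Q) : Q := subsp_val u (subsp_of eA_idem).

Lemma coind_equivariant (u : jstar Q) (b : C) (x : gsub (eA e)) :
  subsp_val u (eA_lact b x) = act b (subsp_val u x).
Proof.
apply: (@isum_ind _ _ _ (@coind_hom _ _ _ _ Q)
  [set f | f (eA_lact b x) = act b (f x)] _ _ _ (subspP u)).
  split; first by rewrite /= -[LHS]/(0 : Q) -[_ x]/(0 : Q) act0r.
  by move=> c f g hf hg; rewrite /= !fct_scale_addE hf hg act_linr.
by move=> id f [_ bf _ _]; exact: bf.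
Qed.

Lemma star_eval_hom : corner_hom corner_projection 0 star_eval.
Proof.
split=> [c u v|d u /coind_degP[_ du]|a u].
- by rewrite /star_eval subsp_val_linear.
- by rewrite addr0 /star_eval -[d]add0r; apply: du; exact: hidem_deg0.
- rewrite /star_eval -coind_equivariant /= /coind_fun; congr (subsp_val u _).
  by apply: subsp_inj; rewrite /= -[RHS]lmulA hidem_idem.
Qed.

(** The value of [u] at [x] is the value of [x u] at [e]. *)
Lemma star_core (u : jstar Q) : (forall a, star_eval (act a u) = 0) -> u = 0.
Proof.
move=> h; apply: subsp_inj; rewrite (linear0f (@subsp_val_linear _ _ _)).
apply: funext => x; rewrite -[RHS](h (subsp_val x)) /star_eval /= /coind_fun.
by congr (subsp_val u _); apply: subsp_inj; rewrite /=; apply/esym/eAP/(subspP x).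
Qed.

(** Coinduction is right adjoint to [V |-> e V]: the homomorphism corresponding to
    [phi] sends [v] to its matrix coefficient [x |-> phi (x v)]. *)
Section Universal.
Context (V : gmod A) (n : int) (phi : V -> Q) (hphi : corner_hom corner_projection n phi).

Definition matrix_coef (v : V) (x : gsub (eA e)) : Q := phi (act (subsp_val x) v).

Lemma matrix_coef_linear : linear matrix_coef.
Proof.
move=> c u v; apply: funext => x.
by rewrite fct_scale_addE /matrix_coef act_linr (ch_linear hphi).
Qed.

Lemma matrix_coef_hom i d v : gdeg d v ->
  coind_hom (i, d + n) (matrix_coef (act (lid A i) v)).
Proof.
move=> hv; split=> [c x y|b x|k x hx|j x /= ji].
- by rewrite /matrix_coef subsp_val_linear act_linl (ch_linear hphi).
- rewrite /matrix_coef -[in RHS](corner_proj_id b) -[RHS](ch_act hphi) /= actA.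
  congr (phi (act _ _)); rewrite -[RHS]actA; congr (act _ _).
  by have /eAP xe := subspP x; exact: esym xe.
- rewrite /= addrA; apply: (ch_deg hphi); apply: act_deg hx _.
  by rewrite -[d]add0r; apply: act_deg hv; exact: lid_deg0.
- rewrite /matrix_coef /= -actA -lmulA lid_orth // lmul0r act0l.
  exact: linear0f (ch_linear hphi).
Qed.

(** Only finitely many [1_i v] are nonzero, so that matrix coefficients belong to the
    direct sum over [i] and not only to the product. *)
Lemma matrix_coef_deg d v : gdeg d v ->
  isum (fun i => coind_hom (i, d + n)) (matrix_coef v).
Proof.
move=> hv; have [r vE] := gmod_dec v.
have hS : is_subspace (isum (fun i => @coind_hom _ _ _ _ Q (i, d + n))).
  by apply: isum_subspace => i; exact: coind_hom_subspace.
rewrite vE (linear_sumf _ _ matrix_coef_linear).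
apply: is_subspace_sum => // i _; apply: (isum1 (j := i)); exact: matrix_coef_hom.
Qed.

Lemma matrix_coef_mem v : coind_subspace Q (matrix_coef v).
Proof.
move: v; apply: (@gspace_ind _ V [set v | coind_subspace Q (matrix_coef v)]) => [|d v hv].
  exact: linear_preimage matrix_coef_linear (subspaceP _).
apply: isum_ind (matrix_coef_deg hv); first exact: subspaceP.
by move=> i f hf; exact: (isum1 (j := (i, d + n))).
Qed.

Definition to_star (v : V) : jstar Q := subsp_of (matrix_coef_mem v).

Lemma to_star_hom : is_hom n to_star.
Proof.
split=> [c u v|a v|d v hv].
- by apply: subsp_inj; rewrite [RHS]subsp_val_linear; exact: matrix_coef_linear.
- by apply: subsp_inj; apply: funext => x; rewrite /= /coind_fun /matrix_coef /= actA.
- exact: matrix_coef_deg.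
Qed.

Lemma star_eval_to_star v : star_eval (to_star v) = phi v.
Proof. exact: (ch_idem hphi). Qed.

End Universal.
End Coinduced.
End CornerProjection.

(** * Modules over a quotient algebra *)

Section QuotientModules.
Context (K : fieldType) (I : choiceType) (A : lualg K I) (N : gideal A).
Context (C : lualg K unit).
Local Notation B := (quo_alg N).

Section Pullback.
Context (kappa : corner_map B C) (e : hidem A).
Context (eE : quo_pi N (hidem_val e) = hidem_val (cm_idem kappa)).

Definition pullback_fun (a : A) : C := kappa (quo_pi N a).

Lemma pullback_linear : linear pullback_fun.
Proof. by move=> c a b; rewrite /pullback_fun quo_pi_linear cm_linear. Qed.

Lemma pullback_deg d a : gdeg d a -> gdeg d (pullback_fun a).
Proof. by move=> ha; apply: cm_deg; exists a. Qed.

Lemma pullback_lift d c : gdeg d c -> exists2 a, gdeg d a & pullback_fun a = c.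
Proof. by move=> /(@cm_lift _ _ _ _ kappa)[_ [a ha <-] <-]; exists a. Qed.

Lemma pullback_mul a b : pullback_fun (lmul (lmul a (hidem_val e)) b) =
  lmul (pullback_fun a) (pullback_fun b).
Proof. by rewrite -(cm_mul kappa) -eE /= !quo_mulE. Qed.

Lemma pullback_one : pullback_fun (hidem_val e) = lid C tt.
Proof. by rewrite /pullback_fun eE cm_one. Qed.

Definition pullback : corner_map A C :=
  CornerMap pullback_linear pullback_deg pullback_lift pullback_mul pullback_one.

End Pullback.

Section Deflation.
Context (V : gmod A) (hV : forall a, N a -> forall v : V, act a v = 0).

Definition deflate_act (u : B) (v : V) : V := act (quo_repr u) v.

Lemma deflate_actE a v : deflate_act (quo_pi N a) v = act a v.
Proof.
apply/eqP; rewrite -subr_eq0 -(linearBf _ _ (act_linl v)); apply/eqP/hV.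
by apply/quo_piP; rewrite quo_reprK.
Qed.

Lemma deflate_linl v : linear (fun u => deflate_act u v).
Proof.
move=> c u w; rewrite -[u]quo_reprK -[w]quo_reprK -quo_pi_linear !deflate_actE.
exact: act_linl.
Qed.

Lemma deflate_linr u : linear (deflate_act u).
Proof. exact: act_linr. Qed.

Lemma deflate_actA (u w : B) v : deflate_act (lmul u w) v = deflate_act u (deflate_act w v).
Proof.
by rewrite -[u]quo_reprK -[w]quo_reprK /= quo_mulE !deflate_actE actA.
Qed.

Lemma deflate_deg d k u v : gdeg d u -> gdeg k v -> gdeg (d + k) (deflate_act u v).
Proof. by move=> [a ha <-] hv; rewrite deflate_actE; exact: act_deg. Qed.

Lemma deflate_sum :
  direct_sum (fun i : I => [set v | exists w, v = deflate_act (lid B i) w]).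
Proof.
split; last exact: act_independent deflate_linl deflate_linr deflate_actA
  (lid_idem B) (@lid_orth _ _ B).
move=> v; have [r [f [ur hf ->]]] := (act_sum V).1 v; exists r, f; split=> // i ir.
by have [w ->] := hf i ir; exists w; rewrite deflate_actE.
Qed.

Definition deflate : gmod B :=
  @GMod _ _ B V deflate_act deflate_linl deflate_linr deflate_actA deflate_deg deflate_sum.

Lemma deflate_hom (W : gmod B) n (f : V -> W) :
  @is_hom _ _ B deflate W n f -> @is_hom _ _ A V (inflate W) n f.
Proof.
move=> [lf af df]; split=> // a v.
by have := af (quo_pi N a) v; rewrite /= deflate_actE.
Qed.

Lemma deflate_corner_hom (kappa : corner_map B C) (e : hidem A) eE (M : gmod C) n
    (phi : V -> M) :
  corner_hom (@pullback kappa e eE) n phi -> @corner_hom _ _ B C kappa deflate M n phi.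
Proof.
move=> [lp dp ap]; split=> // u v.
by rewrite -eE -[u]quo_reprK -[RHS]ap; congr phi; rewrite /= !deflate_actE.
Qed.

End Deflation.

Lemma inflate_corner_hom (kappa : corner_map B C) (e : hidem A) eE (W : gmod B)
    (M : gmod C) n (phi : W -> M) :
  corner_hom kappa n phi ->
  @corner_hom _ _ A C (@pullback kappa e eE) (inflate W) M n phi.
Proof.
move=> [lp dp ap]; split=> // a v; rewrite /= /inflate_act eE; exact: ap.
Qed.

End QuotientModules.

(** * Weights *)

Section Triangularity.
Context (K : fieldType) (I : choiceType) (A : lualg K I).
Context (disp : Order.disp_t) (Lam : porderType disp) (T : triangular_basis A Lam).

Lemma peirce_idl i j a : peirce A i j a -> lmul (lid A i) a = a.
Proof. by case=> b ->; rewrite !lmulA lid_idem. Qed.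

Lemma peirce_idr i j a : peirce A i j a -> lmul a (lid A j) = a.
Proof. by case=> b ->; rewrite -lmulA lid_idem. Qed.

Lemma triangular_ind (W : set A) : is_subspace W ->
  (forall i (s t : tS T) j x h y, tX i s x -> tH s t h -> tY t j y ->
     W (lmul (lmul x h) y)) -> forall a, W a.
Proof.
move=> hW hb a; apply: (span_ind hW _ ((tbasis T).2 a)).
move=> _ [[[x h] y] [s [t [[i Xx] Hh [j Yy]]]] <-]; exact: hb Xx Hh Yy.
Qed.

Lemma e_sumE lam : exists r : seq (tS T),
  [/\ uniq r, forall s, s \in r <-> tdot s = lam & e_ T lam = \sum_(s <- r) lid A (val s)].
Proof.
have /finite_seqP[r0 r0E] := tfiber_finite T lam.
have rE : [set s : tS T | tdot s = lam] = [set` undup r0].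
  by rewrite r0E; apply/seteqP; split=> s /=; rewrite mem_undup.
exists (undup r0); split; [exact: undup_uniq| |].
  by move=> s; have := congr1 (fun S : set _ => S s) rE => /= ->.
by rewrite /e_ rE -fsbig_seq // undup_uniq.
Qed.

Lemma e_lid (s : tS T) : lmul (e_ T (tdot s)) (lid A (val s)) = lid A (val s).
Proof.
have [r [ur rP ->]] := e_sumE (tdot s); have sr : s \in r by exact/rP.
rewrite (linear_sumf _ _ (lmul_linl _)) (bigD1_seq s) //= lid_idem.
rewrite big1 ?addr0 // => t /eqP ts; apply: lid_orth => h.
by apply: ts; exact: val_inj.
Qed.

Lemma e_lid_neq0 lam i : lmul (e_ T lam) (lid A i) <> 0 ->
  exists2 s : tS T, tdot s = lam & i = val s.
Proof.
have [r [_ rP ->]] := e_sumE lam; rewrite (linear_sumf _ _ (lmul_linl _)) => h.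
apply: contrapT => no; apply: h; apply: big1_seq => s /andP[_ /rP sl].
by apply: lid_orth => si; apply: no; exists s.
Qed.

Lemma lid_e_neq0 lam i : lmul (lid A i) (e_ T lam) <> 0 ->
  exists2 s : tS T, tdot s = lam & i = val s.
Proof.
have [r [_ rP ->]] := e_sumE lam; rewrite (linear_sumf _ _ (lmul_linr _)) => h.
apply: contrapT => no; apply: h; apply: big1_seq => s /andP[_ /rP sl].
by apply: lid_orth => si; apply: no; exists s.
Qed.

(** Descent on a list [r] containing everything strictly below [lam], from which each
    step removes an element. *)
Lemma lower_finite_minimal (P : Lam -> Prop) lam : P lam ->
  exists2 mu, P mu & forall nu, (nu < mu)%O -> ~ P nu.
Proof.
have /finite_seqP[r rE] := tlower_finite T lam.
have below nu : (nu < lam)%O -> nu \in r.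
  by move=> h; have : [set` r] nu by rewrite -rE /=; exact: ltW.
(* Generalize over [r] and [lam], keeping a bound on the size of [r]. *)
clear rE; move: {2}(size r) (leqnn (size r)) => n.
elim: n r lam below => [|n IH] r lam below rn Pl.
  exists lam => // nu /below; by move: rn; rewrite leqn0 size_eq0 => /eqP ->.
have [[mu ml Pmu]|no] := pselect (exists2 mu, (mu < lam)%O & P mu); last first.
  by exists lam => // nu nl Pnu; apply: no; exists nu.
apply: (IH [seq nu <- r | nu != mu] mu) => //.
  move=> nu nm; rewrite mem_filter below ?(lt_trans nm ml) // andbT.
  by rewrite (lt_eqF nm).
rewrite -ltnS; apply: leq_trans rn; rewrite size_filter -(count_predC (pred1 mu)).
rewrite -add1n leq_add2r -has_count has_pred1; exact: below.
Qed.

Section Weights.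
Context (V : gmod A).

Definition weight (lam : Lam) : Prop := exists v : V, act (e_ T lam) v <> 0.

Lemma weight_lid (s : tS T) (v : V) : act (lid A (val s)) v <> 0 -> weight (tdot s).
Proof.
by move=> h; exists (act (lid A (val s)) v); rewrite -actA e_lid.
Qed.

(** Every basis element [x h y] passes through some [1_s] with [s] in [tS T], so a module
    without weights is killed by [A]. *)
Lemma weight_exists : (exists v : V, v <> 0) -> exists lam, weight lam.
Proof.
move=> [v0 v00]; apply: contrapT => no; apply: v00.
have kill a : forall v : V, act a v = 0.
  move: a; apply: triangular_ind => [|i s t j x h y Xx _ _ v].
    split=> [v|c a b ha hb v]; first exact: act0l.
    by rewrite act_linl ha hb scaler0 addr0.
  have [px _] := tX_sub Xx; rewrite -(peirce_idr px) !actA.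
  apply: contrapT => n0; apply: no; exists (tdot s); apply: (@weight_lid s (act h (act y v))) => s0.
  by apply: n0; rewrite s0 act0r.
by have [r ->] := gmod_dec v0; apply: big1 => i _.
Qed.

Lemma annihilator_ideal : is_ideal [set a : A | forall v : V, act a v = 0].
Proof.
split=> [|a x hx]; last by split=> v; rewrite actA hx ?act0r.
split=> [v|c a b ha hb v]; first exact: act0l.
by rewrite act_linl ha hb scaler0 addr0.
Qed.

(** If [e_mu x h y e_lam] acts nontrivially, with [h] in [H(s, t)], then [y] starts in
    weight [lam] and ends in [1_t], of weight at most [lam] and hence equal to [lam] by
    minimality; [h] preserves the weight, and [x] can only raise it. *)
Lemma weight_ge lam mu (v : V) a :
  (forall nu, (nu < lam)%O -> ~ weight nu) ->
  act (lmul (e_ T mu) (lmul a (e_ T lam))) v <> 0 -> (lam <= mu)%O.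
Proof.
move=> lmin; apply: contraPP => nle; apply.
move: a; apply: triangular_ind => [|i s t j x h y Xx Hh Yy].
  split=> [|c a b ha hb]; first by rewrite lmul0l lmul0r act0l.
  by rewrite lmul_linl lmul_linr act_linl ha hb scaler0 addr0.
apply: contrapT => n0; apply: nle.
have [px _] := tX_sub Xx; have [py _] := tY_sub Yy.
have [t' t'l jt'] : exists2 t' : tS T, tdot t' = lam & j = val t'.
  apply: lid_e_neq0 => z; apply: n0.
  by rewrite -(peirce_idr py) -!lmulA z !lmul0r act0l.
have [s' s'm is'] : exists2 s' : tS T, tdot s' = mu & i = val s'.
  apply: e_lid_neq0 => z; apply: n0.
  by rewrite -(peirce_idl px) !lmulA z !lmul0l act0l.
have tl : tdot t = lam.
  have [<-//|tt'] := pselect (t' = t); apply: contrapT => _.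
  have tlt : (tdot t < lam)%O.
    rewrite -t'l; apply: tY_tri; first by move=> h'; apply: tt'.
    by exists y; rewrite -jt'.
  case: (lmin _ tlt); apply: (@weight_lid t (act y (act (e_ T lam) v))) => z; apply: n0.
  by rewrite -actA (peirce_idl py) in z; rewrite !actA z !act0r.
have sl : tdot s = lam.
  by have [->//|st] := pselect (s = t); rewrite -tl; apply: (tH_tri st); exists h.
have [ss|ss'] := pselect (s' = s); first by rewrite -sl -s'm ss.
by rewrite -sl -s'm; apply/ltW/(tX_tri ss'); exists x; rewrite -is'.
Qed.

(** The vectors [u] with [e_mu A u = 0] form a submodule. For a minimal weight [lam] and
    [mu] not above it, that submodule contains [e_lam V] by [weight_ge], so it is [V]. *)
Lemma irreducible_lowest_weight : irreducible V ->
  exists lam, weight lam /\ forall mu, ~ (lam <= mu)%O -> forall v : V, act (e_ T mu) v = 0.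
Proof.
move=> irr; have [lam0 w0] := weight_exists irr.1.
have [lam [v v0] lmin] := lower_finite_minimal w0; exists lam; split; first by exists v.
move=> mu nle w; apply: contrapT => w1.
have e0 : is_subspace [set u : V | forall a, act (e_ T mu) (act a u) = 0].
  split=> [a|c x y hx hy a]; first by rewrite !act0r.
  by rewrite !act_linr hx hy scaler0 addr0.
have all : [set u : V | forall a, act (e_ T mu) (act a u) = 0] w.
  apply: (irreducible_submodule irr e0) => [d u hu a|b u hu a|]; last first.
  - exists (act (e_ T lam) v) => // a; apply: contrapT => n0; apply: nle.
    by apply: (@weight_ge _ _ v a lmin); rewrite !actA.
  - rewrite -(actA a b); exact: hu.
  move: a; apply: (@gspace_ind _ A [set a | act (e_ T mu) (act a (gcomp d u)) = 0]).
    apply: (@eq_subspace _ A V (fun a => act (e_ T mu) (act a (gcomp d u))) (fun=> 0)).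
      by move=> c a b; rewrite act_linl act_linr.
    by move=> c a b; rewrite scaler0 addr0.
  move=> k a ha /=; have hmu : gdeg 0 (e_ T mu) by apply: (idem_deg0 (e_homog T mu) (e_idem T mu)).
  by rewrite (act_gcomp _ _ ha) (act_gcomp _ _ hmu) hu (linear0f (gcomp_linear _)).
by apply: w1; rewrite -(e_idem T mu) actA; exact: all.
Qed.

End Weights.
End Triangularity.

(** * Labels of irreducible modules *)

Section Labels.
Context (K : fieldType) (I : choiceType) (A : lualg K I).
Context (disp : Order.disp_t) (Lam : porderType disp) (T : triangular_basis A Lam).

Definition to_A_at (lam : Lam) : corner_map A (A_at T lam) :=
  @pullback _ _ A (ideal_not_ge T lam) _ (corner_projection (ebar T lam))
    (HIdem (e_homog T lam) (e_idem T lam)) erefl.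

Definition killed_below (V : gmod A) (lam : Lam) : Prop :=
  forall a, ideal_not_ge T lam a -> forall v : V, act a v = 0.

(** The first condition says that [V] is inflated from [A_ge lam]; the second
    stands for a nonzero homomorphism, of any degree, from [e_lam V] to [L]. *)
Definition has_label (V : gmod A) (lam : Lam) (L : gmod (A_at T lam)) : Prop :=
  killed_below V lam /\
  exists n (phi : V -> L), corner_hom (to_A_at lam) n phi /\ exists v, phi v <> 0.

Lemma killed_belowP (V : gmod A) lam :
  (forall mu, ~ (lam <= mu)%O -> forall v : V, act (e_ T mu) v = 0) -> killed_below V lam.
Proof.
move=> h a ha; apply: (ha _ (annihilator_ideal V) _).
by move=> _ [mu [nle ->]] v; exact: h.
Qed.

Lemma killed_below_e (V : gmod A) lam mu : killed_below V lam -> ~ (lam <= mu)%O ->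
  forall v : V, act (e_ T mu) v = 0.
Proof. by move=> kV nle; apply: kV => W _; apply; exists mu. Qed.

Lemma has_label_weight (V : gmod A) lam (L : gmod (A_at T lam)) :
  has_label V L -> exists v : V, act (e_ T lam) v <> 0.
Proof.
move=> [_ [n [phi [hphi [v pv]]]]]; exists v => ev; apply: pv.
by rewrite -(ch_idem hphi) /= ev (linear0f (ch_linear hphi)).
Qed.

(** Each of the two values is a weight of [V] and a lower bound of the weights of [V]. *)
Lemma label_weight_unique (V : gmod A) lam lam' (L : gmod (A_at T lam))
    (L' : gmod (A_at T lam')) : has_label V L -> has_label V L' -> lam = lam'.
Proof.
move=> hL hL'; apply: le_anti.
have [v v0] := has_label_weight hL; have [v' v0'] := has_label_weight hL'.
apply/andP; split; apply: contrapT.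
  by move=> nle; apply/v0'/(killed_below_e hL.1 nle).
by move=> nle; apply/v0/(killed_below_e hL'.1 nle).
Qed.

Lemma label_unique (V : gmod A) lam (L L' : gmod (A_at T lam)) :
  irreducible V -> irreducible L -> irreducible L' ->
  has_label V L -> has_label V L' -> exists n, iso L (shift L' n).
Proof.
move=> irr irrL irrL' [_ [n [phi [hphi p0]]]] [_ [n' [phi' [hphi' p0']]]].
by exists (n' - n); exact: corner_homs_iso hphi hphi' p0 p0'.
Qed.

Lemma has_label_iso (V V' : gmod A) lam (L : gmod (A_at T lam)) n :
  iso V (shift V' n) -> has_label V' L -> has_label V L.
Proof.
move=> [f [/hom_shift hf [g fK gK]]] [kV' [m [phi [hphi [v pv]]]]]; split.
  move=> a ha u; apply: (can_inj fK).
  by rewrite (hom0 hf) (hom_act hf); exact: kV'.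
exists (0 + n + m), (phi \o f); split; first exact: hom_corner_comp hf hphi.
by exists (g v); rewrite /= gK.
Qed.

(** For the lowest weight [lam] of [V], [e_lam V] is an irreducible [A_lam]-module, and
    [b] is its place in the classification over [A_lam]. *)
Lemma label_exists (B : Lam -> Type) (L : forall lam, B lam -> gmod (A_at T lam))
    (V : gmod A) : (forall lam, full_irreducibles (L lam)) -> irreducible V ->
  exists b : {lam & B lam}, has_label V (L (projT1 b) (projT2 b)).
Proof.
move=> hL irr; have [lam [wlam wmin]] := irreducible_lowest_weight T irr.
have kV := killed_belowP wmin.
have hV a : to_A_at lam a = 0 -> forall v : V,
    act (e_ T lam) (act a (act (e_ T lam) v)) = 0.
  move=> h v; have /quo_pi0 ha : quo_pi (ideal_not_ge T lam)
      (lmul (lmul (e_ T lam) a) (e_ T lam)) = 0.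
    have := congr1 (@subsp_val _ _ _) h.
    rewrite (linear0f (@subsp_val_linear _ _ (eAe (ebar T lam)))) => <-.
    by rewrite -!quo_mulE.
  by rewrite -[RHS](kV _ ha v) !actA.
have irrE := corner_irreducible hV irr wlam.
have [b [[n [f [/hom_shift hf [g fK gK]]]] _]] := (hL lam).2 _ irrE.
exists (existT _ lam b); split=> //=.
exists (0 + (0 + n)), (f \o to_corner hV); split.
  exact: corner_hom_comp (to_corner_hom hV) hf.
have [v ev] := wlam; exists v => /= fv; apply: ev.
have : to_corner hV v = 0 by apply: (can_inj fK); rewrite fv (hom0 hf).
move=> /(congr1 (@subsp_val _ _ _)) /= ->.
exact: linear0f (@subsp_val_linear _ _ (eV (to_A_at lam) V)).
Qed.

Section OneLabel.
Context (lam : Lam) (L P Q : gmod (A_at T lam)).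
Context (irrL : irreducible L) (hP : projective_cover P L) (hQ : injective_hull Q L).

Lemma inflate_killed_below (W : gmod (A_ge T lam)) : killed_below (inflate W) lam.
Proof.
by move=> a ha v; rewrite /= /inflate_act (iffRL (quo_pi0 _ _) ha) act0l.
Qed.

Lemma quotient_killed_below (V : gmod A) (N : gsubmod V) :
  killed_below V lam -> killed_below (quo_gmod N) lam.
Proof.
move=> kV a ha u; rewrite -(quo_reprK u) -(hom_act (quo_pi_hom N)) kV //.
exact: hom0 (quo_pi_hom N).
Qed.

(** Being onto [L] is being onto [P], as [P -> L] is superfluous, and a submodule onto [P]
    is the whole standard module; [core_maximal] applies. *)
Lemma standard_head : exists N : gsubmod (standard P),
  [/\ irreducible (quo_gmod N),
      forall N' : gsubmod (standard P), irreducible (quo_gmod N') -> forall v, N' v <-> N v,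
      killed_below (quo_gmod N) lam &
      exists phi : quo_gmod N -> L, corner_hom (to_A_at lam) 0 phi /\ exists v, phi v <> 0].
Proof.
have [_ [p [hp pS pC]]] := hP.
have hproj : @corner_hom _ _ A _ (to_A_at lam) (standard P) P 0 (@shriek_proj _ _ _ _ P).
  by apply: inflate_corner_hom; exact: shriek_proj_hom.
have := corner_hom_comp hproj hp; set phi := p \o _; rewrite addr0 => hphi.
have gen (N : gsubmod (standard P)) :
    (forall m, exists2 v, N v & phi v = m) -> forall v, N v.
  move=> cov; apply: (shriek_generated (subspaceP N)) => [u v Nv|].
    rewrite -(quo_reprK u); exact: (gsubmodP (quo_repr u) Nv).
  apply: (pC (ch_image hproj N)) => l; have [v Nv <-] := cov l.
  by exists (shriek_proj v) => //; exists v.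
have [l l0] := irrL.1.
have phi0 : exists v, phi v <> 0.
  apply: contrapT => no; apply: l0; have [x <-] := pS l.
  apply: contrapT => px; apply: no.
  by exists (tens (subsp_of (Ae_idem (ebar T lam))) x); rewrite /phi /= shriek_proj_unit.
have [irrN uniqN] := core_maximal hphi irrL phi0 gen.
exists (core hphi); split=> //.
  by apply: quotient_killed_below; exact: inflate_killed_below.
exists (core_factor (hphi := hphi)); split; first exact: core_factor_hom.
by have [v pv] := phi0; exists (quo_pi (core hphi) v); rewrite core_factorE.
Qed.

(** Followed by [L -> Q], [phi] lifts to the costandard module by coinduction; the lift is
    nonzero because evaluation at [e] returns [phi]. *)
Lemma costandard_embedding (V : gmod A) n (phi : V -> L) : irreducible V ->
  killed_below V lam -> corner_hom (to_A_at lam) n phi -> (exists v, phi v <> 0) ->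
  exists F : V -> costandard Q, is_hom n F /\ injective F.
Proof.
move=> irr kV hphi [v pv]; have [_ [i [hi iI _]]] := hQ.
have := deflate_corner_hom kV (corner_hom_comp hphi hi); rewrite addr0 => hpsi.
have hF := deflate_hom (to_star_hom hpsi).
exists (to_star hpsi); split=> //; apply: (irreducible_hom_inj hF irr).
exists v => Fv; apply: pv; apply: iI; rewrite (hom0 hi).
rewrite -[LHS](star_eval_to_star hpsi) Fv.
exact: linear0f (ch_linear (star_eval_hom Q)).
Qed.

Lemma costandard_uniform (N N' : gsubmod (costandard Q)) :
  (exists2 v, N v & v <> 0) -> (exists2 v, N' v & v <> 0) ->
  exists v, [/\ N v, N' v & v <> 0].
Proof.
have [_ [i [hi iI ess]]] := hQ.
have heval : @corner_hom _ _ A _ (to_A_at lam) (costandard Q) Q 0 (@star_eval _ _ _ _ Q).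
  by apply: inflate_corner_hom; exact: star_eval_hom.
apply: (essential_core_uniform heval _ irrL hi iI ess) => w hw.
by apply: star_core => u; rewrite -(quo_reprK u); exact: hw.
Qed.

(** The image of [F] meets [N], and the preimage of [N] is a submodule of the
    irreducible [V]. *)
Lemma costandard_image_le (V : gmod A) n (F : V -> costandard Q)
    (N : gsubmod (costandard Q)) : irreducible V -> is_hom n F -> injective F ->
  (exists2 v, N v & v <> 0) -> forall v, N (F v).
Proof.
move=> irr hF FI hN.
have [||_ [[v _ <-] NFv F0]] := @costandard_uniform (hom_image hF (whole_module V)) N.
- have [v v0] := irr.1; exists (F v); first by exists v.
  by rewrite -(hom0 hF) => /FI.
- exact: hN.
have [h|//] := irr.2 (hom_preimage hF N).
by case: F0; rewrite (h v NFv) (hom0 hF).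
Qed.

Lemma costandard_images (V V' : gmod A) n n' (F : V -> costandard Q)
    (F' : V' -> costandard Q) : irreducible V -> irreducible V' ->
  is_hom n F -> is_hom n' F' -> injective F -> injective F' ->
  forall w, (exists v, F v = w) <-> exists v, F' v = w.
Proof.
have le (U U' : gmod A) m m' (G : U -> costandard Q) (G' : U' -> costandard Q) :
    irreducible U -> irreducible U' -> is_hom m G -> is_hom m' G' ->
    injective G -> injective G' -> forall u, exists u', G' u' = G u.
  move=> iU iU' hG hG' GI GI' u.
  have [|u' _ u'E] := costandard_image_le (N := hom_image hG' (whole_module U')) iU hG GI _ u.
    have [u' u'0] := iU'.1; exists (G' u'); first by exists u'.
    by rewrite -(hom0 hG') => /GI'.
  by exists u'.
move=> irr irr' hF hF' FI FI' w; split=> -[v <-].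
  exact: le irr irr' hF hF' FI FI' v.
exact: le irr' irr hF' hF FI' FI v.
Qed.

(** Both modules embed in the costandard module, with the same image. *)
Lemma label_iso (V V' : gmod A) n n' (phi : V -> L) (phi' : V' -> L) :
  irreducible V -> irreducible V' -> killed_below V lam -> killed_below V' lam ->
  corner_hom (to_A_at lam) n phi -> corner_hom (to_A_at lam) n' phi' ->
  (exists v, phi v <> 0) -> (exists v, phi' v <> 0) -> iso V (shift V' (n - n')).
Proof.
move=> irr irr' kV kV' hphi hphi' p0 p0'.
have [F [hF FI]] := costandard_embedding irr kV hphi p0.
have [F' [hF' FI']] := costandard_embedding irr' kV' hphi' p0'.
by apply: (homs_same_image hF hF' FI FI'); exact: (costandard_images irr irr' hF hF' FI FI').
Qed.

Lemma sub_val_hom (V : gmod A) (N : gsubmod V) :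
  @is_hom _ _ A (sub_gmod N) V 0 (@subsp_val _ _ N).
Proof. by split=> // d u hu; rewrite addr0. Qed.

(** [V] embeds in the costandard module, and any irreducible submodule, embedded by
    inclusion, has the same image. *)
Lemma costandard_socle (V : gmod A) (phi : V -> L) : irreducible V ->
  killed_below V lam -> corner_hom (to_A_at lam) 0 phi -> (exists v, phi v <> 0) ->
  unique_irreducible_submodule (costandard Q) V.
Proof.
move=> irr kV hphi p0; have [F [hF FI]] := costandard_embedding irr kV hphi p0.
pose N := hom_image hF (whole_module V).
have NF v : N (F v) by exists v.
have hG : @is_hom _ _ A V (sub_gmod N) 0 (fun v => subsp_of (NF v)).
  split=> [c u v|a v|d v hv]; last exact: (hom_deg hF hv).
    by apply: subsp_inj; rewrite [RHS]subsp_val_linear; exact: hom_linear hF c u v.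
  by apply: subsp_inj; exact: hom_act hF a v.
have GI : injective (fun v => subsp_of (NF v) : sub_gmod N).
  by move=> u v /(congr1 (@subsp_val _ _ _)) /FI.
have GS (w : sub_gmod N) : exists v, subsp_of (NF v) = w.
  by have [v _ vE] := subspP w; exists v; exact: subsp_inj.
have [g [_ gK Kg]] := hom_bijective hG GI GS.
exists N; split.
- exact: irreducible_bijective hG GI GS irr.
- by exists (fun v => subsp_of (NF v)); split=> //; exists g.
- move=> N' irrN' w.
  have valI : injective (@subsp_val _ _ N' : sub_gmod N' -> _) by exact: subsp_inj.
  have im := costandard_images irr irrN' hF (sub_val_hom N') FI valI w.
  split=> [N'w|[v _ vw]].
    by have [v vw] := iffRL im (ex_intro _ (subsp_of N'w) erefl); exists v.
  by have [u <-] := iffLR im (ex_intro _ v vw); exact: subspP.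
Qed.

End OneLabel.
End Labels.

Lemma hom_id (K : fieldType) (I : choiceType) (A : lualg K I) (V : gmod A) :
  @is_hom _ _ A V V 0 id.
Proof. by split=> // d v; rewrite addr0. Qed.


Theorem theorem4p3 (K : closedFieldType) (I : choiceType) (A : lualg K I)
    (hfd : locally_findim A) (hbb : bounded_below A)
    (disp : Order.disp_t) (Lam : porderType disp) (T : triangular_basis A Lam)
    (B : Lam -> Type)
    (Lat Pat Qat : forall lam : Lam, B lam -> gmod (A_at T lam))
    (hL : forall lam : Lam, full_irreducibles (Lat lam))
    (hP : forall (lam : Lam) (b : B lam), projective_cover (Pat lam b) (Lat lam b))
    (hQ : forall (lam : Lam) (b : B lam), injective_hull (Qat lam b) (Lat lam b)) :
  let Delta (b : {lam : Lam & B lam}) := standard (Pat (projT1 b) (projT2 b)) in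
  let nabla (b : {lam : Lam & B lam}) := costandard (Qat (projT1 b) (projT2 b)) in
  exists L : {lam : Lam & B lam} -> gmod A,
    [/\ forall b, unique_irreducible_quotient (Delta b) (L b),
        forall b, unique_irreducible_submodule (nabla b) (L b) &
        full_irreducibles L].

Proof.
pose Lb (b : {lam : Lam & B lam}) := Lat (projT1 b) (projT2 b).
move=> Delta nabla.
have irrL b : irreducible (Lb b) := (hL (projT1 b)).1 (projT2 b).
have head b := cid (standard_head (irrL b) (hP (projT1 b) (projT2 b))).
pose N b := projT1 (head b); pose L b := quo_gmod (N b).
have irr b : irreducible (L b) by case: (projT2 (head b)).
have kL b : killed_below T (L b) (projT1 b) by case: (projT2 (head b)).
have phiL b : exists phi : L b -> Lb b,
    corner_hom (to_A_at T (projT1 b)) 0 phi /\ exists v, phi v <> 0.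
  by case: (projT2 (head b)).
have labelL b : has_label (L b) (Lb b).
  by split; [exact: kL|have [phi hphi] := phiL b; exists 0, phi].
exists L; split=> [b|b|].
- exists (N b); split; [exact: irr| |by case: (projT2 (head b))].
  by exists id; split; [exact: hom_id|exists id].
- have [phi [hphi phi0]] := phiL b.
  exact: (costandard_socle (irrL b) (hQ (projT1 b) (projT2 b)) (irr b) (kL b) hphi phi0).
split=> // V irrV; have [b labelV] := label_exists hL irrV.
exists b; split.
  have [kV [n [phi [hphi phi0]]]] := labelV.
  have [phi' [hphi' phi0']] := phiL b.
  exists (n - 0).
  exact: (label_iso (irrL b) (hQ (projT1 b) (projT2 b)) irrV (irr b) kV (kL b)
    hphi hphi' phi0 phi0').
move=> b' [n isoV].
have labelV' := has_label_iso isoV (labelL b').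
have lamE := label_weight_unique labelV labelV'.
clear isoV; case: b b' labelV labelV' lamE => [lam c] [lam' c'] /= labelV labelV' lamE.
subst lam'; congr existT.
have [d isoc] := label_unique irrV ((hL lam).1 c) ((hL lam).1 c') labelV labelV'.
have [c0 [_ c0E]] := (hL lam).2 _ ((hL lam).1 c).
rewrite -(c0E c); last by exists 0; by apply: (iso_shift (hom_id _)) => // w; exists w.
by apply: c0E; exists d.
Qed.
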